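(* Let $X$ be a scheme with structure sheaf $\mathcal{O}_X$. A complex $\mathscr{F}_\bullet$ of flat quasi-coherent sheaves on $X$ is $\mathbf{F}$-totally acyclic if there exists an affine open covering $\mathcal{U}$ of $X$ such that the complex $\mathscr{F}_\bullet(U)$ of flat $\mathcal{O}_X(U)$-modules is $\mathbf{F}$-totally acyclic for every $U\in\mathcal{U}$.
   Context: For a commutative ring $R$, a ($\mathbb{Z}$-indexed) complex $F_\bullet$ of flat $R$-modules is called $\mathbf{F}$-totally acyclic if it is acyclic and $I\otimes_R F_\bullet$ is acyclic for every injective $R$-module $I$. For a scheme $X$, a complex $\mathscr{F}_\bullet=\cdots\to\mathscr{F}_{i+1}\to\mathscr{F}_i\to\mathscr{F}_{i-1}\to\cdots$ of flat quasi-coherent sheaves on $X$ is called $\mathbf{F}$-totally acyclic if for every open affine subset $U\subseteq X$ the complex $\mathscr{F}_\bullet(U)$ of flat $\mathcal{O}_X(U)$-modules is $\mathbf{F}$-totally acyclic. *)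

(* Defs.v *)
From HB Require Import structures.
From mathcomp Require Import all_boot all_order all_algebra.
From mathcomp Require Import generic_quotient.
From mathcomp Require Import boolp classical_sets topology.

Set Implicit Arguments.
Unset Strict Implicit.
Unset Printing Implicit Defensive.

Import GRing.Theory.
Local Open Scope ring_scope.
Local Open Scope classical_set_scope.
Local Open Scope quotient_scope.

(* M (x)_R N: formal finite sums of pairs (m, n), modulo the congruence
   generated by the bilinearity relations. As formal sums are lists, i.e. a
   monoid and not a group, tensor_rel0 has to be imposed separately. *)
Section Tensor.
Context (R : comPzRingType) (M N : lmodType R).

Inductive tensor_rel : seq (M * N) -> seq (M * N) -> Prop :=
| tensor_refl s : tensor_rel s s
| tensor_sym s t : tensor_rel s t -> tensor_rel t s
| tensor_trans s t u : tensor_rel s t -> tensor_rel t u -> tensor_rel s u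
| tensor_cat s s' t t' :
    tensor_rel s s' -> tensor_rel t t' -> tensor_rel (s ++ t) (s' ++ t')
| tensor_catC s t : tensor_rel (s ++ t) (t ++ s)
| tensor_rel0 n : tensor_rel [:: (0, n)] [::]
| tensor_relDl m m' n : tensor_rel [:: (m + m', n)] [:: (m, n); (m', n)]
| tensor_relDr m n n' : tensor_rel [:: (m, n + n')] [:: (m, n); (m, n')]
| tensor_relZ (a : R) m n : tensor_rel [:: (a *: m, n)] [:: (m, a *: n)].

Definition tensor_relb (s t : seq (M * N)) : bool := `[< tensor_rel s t >].

Lemma tensor_relb_refl : reflexive tensor_relb.
Proof. by move=> s; apply/asboolP; exact: tensor_refl. Qed.

Lemma tensor_relb_sym : symmetric tensor_relb.
Proof.
by move=> s t; apply/asboolP/asboolP => st; exact: tensor_sym.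
Qed.

Lemma tensor_relb_trans : transitive tensor_relb.
Proof.
move=> t s u /asboolP st /asboolP tu; apply/asboolP.
exact: tensor_trans st tu.
Qed.

Canonical tensor_equiv :=
  EquivRel tensor_relb tensor_relb_refl tensor_relb_sym tensor_relb_trans.

Definition tensor := {eq_quot tensor_equiv}.

HB.instance Definition _ := Choice.on tensor.

Definition tensor_class (s : seq (M * N)) : tensor := \pi_tensor s.

Lemma tensor_classP s t : tensor_class s = tensor_class t <-> tensor_rel s t.
Proof.
split=> [/eqP|st]; first by rewrite /tensor_class eqmodE => /asboolP.
by apply/eqP; rewrite /tensor_class eqmodE; apply/asboolP.
Qed.

Lemma tensor_classK (x : tensor) : tensor_class (repr x) = x.
Proof. exact: reprK. Qed.

Lemma tensor_ind (P : tensor -> Prop) :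
  (forall s, P (tensor_class s)) -> forall x, P x.
Proof. by move=> Ps x; rewrite -(tensor_classK x). Qed.

Lemma tensor_rel_repr s : tensor_rel (repr (tensor_class s)) s.
Proof. by apply/tensor_classP; rewrite tensor_classK. Qed.

Definition tensor_scale_seq (a : R) (s : seq (M * N)) : seq (M * N) :=
  [seq (a *: p.1, p.2) | p <- s].

Lemma tensor_rel_scale a s t :
  tensor_rel s t -> tensor_rel (tensor_scale_seq a s) (tensor_scale_seq a t).
Proof.
elim=> {s t} [s|s t _ st|s t u _ st _ tu|s s' t t' _ ss' _ tt'|s t|n|m m' n
  |m n n'|b m n] /=.
- exact: tensor_refl.
- exact: tensor_sym.
- exact: tensor_trans tu.
- by rewrite /tensor_scale_seq !map_cat; exact: tensor_cat.
- by rewrite /tensor_scale_seq !map_cat; exact: tensor_catC.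
- by rewrite scaler0; exact: tensor_rel0.
- by rewrite scalerDr; exact: tensor_relDl.
- exact: tensor_relDr.
- by rewrite scalerA mulrC -scalerA; exact: tensor_relZ.
Qed.

Definition tensor_zero : tensor := tensor_class [::].
Definition tensor_add (x y : tensor) : tensor :=
  tensor_class (repr x ++ repr y).
Definition tensor_scale (a : R) (x : tensor) : tensor :=
  tensor_class (tensor_scale_seq a (repr x)).
Definition tensor_opp (x : tensor) : tensor := tensor_scale (-1) x.

Lemma tensor_addE s t :
  tensor_add (tensor_class s) (tensor_class t) = tensor_class (s ++ t).
Proof.
by apply/tensor_classP; apply: tensor_cat; exact: tensor_rel_repr.
Qed.

Lemma tensor_scaleE a s :
  tensor_scale a (tensor_class s) = tensor_class (tensor_scale_seq a s).
Proof.
by apply/tensor_classP; apply: tensor_rel_scale; exact: tensor_rel_repr.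
Qed.

Lemma tensor_addA : associative tensor_add.
Proof.
elim/tensor_ind=> s; elim/tensor_ind=> t; elim/tensor_ind=> u.
by rewrite !tensor_addE catA.
Qed.

Lemma tensor_addC : commutative tensor_add.
Proof.
elim/tensor_ind=> s; elim/tensor_ind=> t.
by rewrite !tensor_addE; apply/tensor_classP; exact: tensor_catC.
Qed.

Lemma tensor_add0 : left_id tensor_zero tensor_add.
Proof. by elim/tensor_ind=> s; rewrite tensor_addE. Qed.

Lemma tensor_scaleA a b x :
  tensor_scale a (tensor_scale b x) = tensor_scale (a * b) x.
Proof.
elim/tensor_ind: x => s; rewrite !tensor_scaleE /tensor_scale_seq -map_comp.
by congr tensor_class; apply: eq_map => p /=; rewrite scalerA.
Qed.

Lemma tensor_scale1 : left_id 1 tensor_scale.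
Proof.
elim/tensor_ind=> s; rewrite tensor_scaleE; congr tensor_class.
by rewrite -[RHS]map_id; apply: eq_map => -[m n] /=; rewrite scale1r.
Qed.

Lemma tensor_scaleDr : right_distributive tensor_scale tensor_add.
Proof.
move=> a; elim/tensor_ind=> s; elim/tensor_ind=> t.
by rewrite (tensor_addE s t) !tensor_scaleE tensor_addE /tensor_scale_seq map_cat.
Qed.

Lemma tensor_scaleDl x :
  {morph tensor_scale^~ x : a b / a + b >-> tensor_add a b}.
Proof.
move=> a b; elim/tensor_ind: x => s.
rewrite !tensor_scaleE tensor_addE; apply/tensor_classP.
elim: s => [|[m n] s IHs] /=; first exact: tensor_refl.
rewrite scalerDl -cat1s -[_ :: _ ++ _]cat1s.
apply: (@tensor_trans _ ([:: (a *: m, n); (b *: m, n)] ++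
  (tensor_scale_seq a s ++ tensor_scale_seq b s))).
  by apply: tensor_cat => //; exact: tensor_relDl.
rewrite /= -cat1s -[X in tensor_rel _ X]cat1s.
apply: tensor_cat; first exact: tensor_refl.
rewrite -cat1s -[(b *: m, n) :: tensor_scale_seq b s]cat1s !catA.
by apply: tensor_cat; [exact: tensor_catC|exact: tensor_refl].
Qed.

Lemma tensor_scale0 x : tensor_scale 0 x = tensor_zero.
Proof.
elim/tensor_ind: x => s; rewrite tensor_scaleE; apply/tensor_classP.
elim: s => [|[m n] s IHs] /=; first exact: tensor_refl.
rewrite -cat1s -[X in tensor_rel _ X]cat0s scale0r.
by apply: tensor_cat => //; exact: tensor_rel0.
Qed.

Lemma tensor_addN : left_inverse tensor_zero tensor_opp tensor_add.
Proof.
move=> x; rewrite /tensor_opp -{2}[x]tensor_scale1 -tensor_scaleDl addNr.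
exact: tensor_scale0.
Qed.

HB.instance Definition _ :=
  GRing.isZmodule.Build tensor tensor_addA tensor_addC tensor_add0 tensor_addN.
HB.instance Definition _ := GRing.Zmodule_isLmodule.Build R tensor
  tensor_scaleA tensor_scale1 tensor_scaleDr tensor_scaleDl.

End Tensor.

(* The map M (x) f, sending m (x) n to m (x) f n. *)
Section TensorMap.
Context (R : comPzRingType) (M N N' : lmodType R) (f : {linear N -> N'}).

Definition tensor_map_seq (s : seq (M * N)) : seq (M * N') :=
  [seq (p.1, f p.2) | p <- s].

Definition tensor_map (x : tensor M N) : tensor M N' :=
  tensor_class (tensor_map_seq (repr x)).

Lemma tensor_rel_map s t :
  tensor_rel s t -> tensor_rel (tensor_map_seq s) (tensor_map_seq t).
Proof.
elim=> {s t} [s|s t _ st|s t u _ st _ tu|s s' t t' _ ss' _ tt'|s t|n|m m' n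
  |m n n'|b m n] /=.
- exact: tensor_refl.
- exact: tensor_sym.
- exact: tensor_trans tu.
- by rewrite /tensor_map_seq !map_cat; exact: tensor_cat.
- by rewrite /tensor_map_seq !map_cat; exact: tensor_catC.
- exact: tensor_rel0.
- exact: tensor_relDl.
- by rewrite linearD; exact: tensor_relDr.
- by rewrite linearZ; exact: tensor_relZ.
Qed.

Lemma tensor_mapE s :
  tensor_map (tensor_class s) = tensor_class (tensor_map_seq s).
Proof.
by apply/tensor_classP; apply: tensor_rel_map; exact: tensor_rel_repr.
Qed.

Lemma tensor_map_is_linear : linear tensor_map.
Proof.
move=> a; elim/tensor_ind=> s; elim/tensor_ind=> t.
have lin (P : lmodType R) (u v : seq (M * P)) :
    a *: tensor_class u + tensor_class v =
    tensor_class (tensor_scale_seq a u ++ v).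
  rewrite [a *: tensor_class u](tensor_scaleE a u).
  exact: tensor_addE.
rewrite lin (tensor_mapE s) (tensor_mapE t) lin tensor_mapE.
by rewrite /tensor_map_seq map_cat /tensor_scale_seq -!map_comp.
Qed.

HB.instance Definition _ :=
  GRing.isLinear.Build R (tensor M N) (tensor M N') _ tensor_map
    tensor_map_is_linear.

End TensorMap.

Section Modules.
Context (R : comPzRingType).

Definition flat (M : lmodType R) : Prop :=
  forall (N N' : lmodType R) (f : {linear N -> N'}),
    injective f -> injective (tensor_map (M := M) f).

Definition injective_module (I : lmodType R) : Prop :=
  forall (N N' : lmodType R) (i : {linear N -> N'}) (g : {linear N -> I}),
    injective i -> exists g' : {linear N' -> I}, forall x, g' (i x) = g x.

Record complex := Complex {
  cplx :> int -> lmodType R;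
  cdiff : forall i : int, {linear cplx (i + 1) -> cplx i};
  cdiff_cdiff : forall (i : int) (x : cplx (i + 1 + 1)),
    cdiff i (cdiff (i + 1) x) = 0
}.

Definition acyclic (C : complex) : Prop :=
  forall (i : int) (x : C (i + 1)),
    cdiff C i x = 0 -> exists y : C (i + 1 + 1), cdiff C (i + 1) y = x.

Section TensorComplex.
Context (I : lmodType R) (C : complex).

Lemma tensor_diff_diff (i : int) (x : tensor I (C (i + 1 + 1))) :
  tensor_map (cdiff C i) (tensor_map (cdiff C (i + 1)) x) = 0.
Proof.
elim/tensor_ind: x => s; rewrite !tensor_mapE /tensor_map_seq -map_comp.
rewrite (@eq_map _ _ _ (fun p => (p.1, 0 : C i))); last first.
  by move=> p /=; rewrite cdiff_cdiff.
rewrite -[RHS](scale0r (tensor_class [seq (p.1, 0 : C i) | p <- s])).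
rewrite [RHS]tensor_scaleE; apply/tensor_classP.
elim: s => [|[m n] s IHs] /=; first exact: tensor_refl.
rewrite -cat1s -[X in tensor_rel _ X]cat1s.
apply: tensor_cat => //; rewrite scale0r.
rewrite -[X in tensor_rel [:: (m, X)] _](scale0r (0 : C i)).
by apply: tensor_sym; rewrite -{1}(scale0r m); exact: tensor_relZ.
Qed.

Definition tensor_complex : complex :=
  @Complex (fun i => tensor I (C i)) (fun i => tensor_map (cdiff C i))
    tensor_diff_diff.

End TensorComplex.

Definition F_totally_acyclic (C : complex) : Prop :=
  [/\ forall i, flat (C i),
      acyclic C
    & forall I : lmodType R, injective_module I ->
        acyclic (tensor_complex I C)].

End Modules.

Section Spec.
Context (A : comPzRingType).

Definition prime_ideal (p : set A) : Prop :=
  [/\ p 0, forall a b, p a -> p b -> p (a + b), forall a b, p b -> p (a * b),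
      ~ p 1 & forall a b, p (a * b) -> p a \/ p b].

Record spec := Spec { ideal_of :> set A; ideal_ofP : prime_ideal ideal_of }.

HB.instance Definition _ := gen_eqMixin spec.
HB.instance Definition _ := gen_choiceMixin spec.

Definition spec_open : set (set spec) :=
  [set W | exists E : set A, W = [set p : spec | ~ E `<=` p]].

Lemma spec_openT : spec_open setT.
Proof.
exists [set 1]; apply/seteqP; split=> // p _ /(_ 1 erefl).
by case: (ideal_ofP p).
Qed.

Lemma spec_openI : setI_closed spec_open.
Proof.
move=> _ _ [E ->] [E' ->]; exists [set a * b | a in E & b in E'].
apply/seteqP; split=> p /=.
  move=> [/existsNP[a /not_implyP[Ea pa]] /existsNP[b /not_implyP[Eb pb]]].
  have [_ _ _ _ pM] := ideal_ofP p.
  by move=> /(_ (a * b)) /(_ (ex_intro2 _ _ a Ea (ex_intro2 _ _ b Eb erefl)));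
     move=> /pM[].
have [_ _ pM _ _] := ideal_ofP p.
move=> nEE; split=> sub; apply: nEE => _ [a Ea [b Eb <-]].
  by rewrite mulrC; apply: pM; exact: sub.
by apply: pM; exact: sub.
Qed.

Lemma spec_open_bigcup (I : Type) (f : I -> set spec) :
  (forall i, spec_open (f i)) -> spec_open (\bigcup_i f i).
Proof.
move=> /choice[E fE]; exists (\bigcup_i E i); apply/seteqP; split=> p /=.
  by move=> [i _]; rewrite fE /= => nE sub; apply: nE => a Ea; apply: sub; exists i.
move=> /existsNP[a /not_implyP[[i _ Ea] pa]]; exists i => //.
by rewrite fE /= => /(_ a Ea).
Qed.

HB.instance Definition _ :=
  isOpenTopological.Build spec spec_openT spec_openI spec_open_bigcup.

Definition basic_open (f : A) : set spec := [set p : spec | ~ ideal_of p f].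

End Spec.

(* phi : A -> B exhibits B as the ring of fractions A_f. *)
Definition is_ring_localization (A B : comPzRingType) (f : A) (phi : A -> B) :=
  [/\ exists b, phi f * b = 1,
      forall b, exists a n, phi (f ^+ n) * b = phi a
    & forall a, phi a = 0 -> exists n, f ^+ n * a = 0].

(* h : M -> N, semilinear along phi : A -> B, exhibits N as the module of
   fractions M_f. *)
Definition is_module_localization (A B : comPzRingType) (M : lmodType A)
    (N : lmodType B) (f : A) (phi : A -> B) (h : M -> N) :=
  [/\ bijective (fun n : N => phi f *: n),
      forall n, exists m k, phi (f ^+ k) *: n = h m
    & forall m, h m = 0 -> exists k, f ^+ k *: m = 0].

Record opens (X : topologicalType) := Opens {
  opens_set :> set X;
  opens_open : open opens_set
}.

Definition opensI (X : topologicalType) (U V : opens X) : opens X :=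
  Opens (openI (opens_open U) (opens_open V)).

Lemma opensIl (X : topologicalType) (U V : opens X) : opensI U V `<=` U.
Proof. by move=> x []. Qed.

Lemma opensIr (X : topologicalType) (U V : opens X) : opensI U V `<=` V.
Proof. by move=> x []. Qed.

Definition sheaf_axiom (X : topologicalType) (F : opens X -> Type)
    (res : forall U V : opens X, V `<=` U -> F U -> F V) : Prop :=
  forall (U : opens X) (I : Type) (V : I -> opens X)
    (VU : forall i, V i `<=` U) (s : forall i, F (V i)),
  U `<=` \bigcup_i V i ->
  (forall i j, res _ _ (@opensIl X (V i) (V j)) (s i) =
               res _ _ (@opensIr X (V i) (V j)) (s j)) ->
  exists! t : F U, forall i, res _ _ (VU i) t = s i.

(* The laws quantify over all proofs of inclusion, so that res does not depend
   on them. *)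
Record ringed_space := RingedSpace {
  space :> topologicalType;
  Osheaf : opens space -> comPzRingType;
  Ores : forall U V : opens space, V `<=` U -> {rmorphism Osheaf U -> Osheaf V};
  Ores_id : forall (U : opens space) (UU : U `<=` U) s, Ores UU s = s;
  Ores_comp : forall (U V W : opens space) (VU : V `<=` U) (WV : W `<=` V)
    (WU : W `<=` U) s, Ores WV (Ores VU s) = Ores WU s;
  Osheaf_axiom : sheaf_axiom (fun U V VU => Ores VU : _ -> _)
}.

(* An isomorphism of ringed spaces from Spec A onto the open subspace U of X:
   a homeomorphism psi from Spec A onto U, and an isomorphism between the
   structure sheaves. As the structure sheaf of Spec A is the sheaf whose
   sections over each D(f) are A_f, the latter amounts to a ring morphism
   alpha : A -> O_X(U) inducing A_f = O_X(psi(D(f))) for every f. *)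
Record spec_iso (X : ringed_space) (A : comPzRingType) (U : opens X) := SpecIso {
  iso_map :> spec A -> X;
  iso_ring : {rmorphism A -> Osheaf U};
  iso_inj : injective iso_map;
  iso_range : range iso_map = U;
  iso_continuous : continuous iso_map;
  iso_open : forall W : set (spec A), open W -> open (iso_map @` W);
  iso_sheaf : forall (f : A) (V : opens X) (VU : V `<=` U),
    V = iso_map @` basic_open f :> set X ->
    is_ring_localization f (Ores VU \o iso_ring)
}.

Definition affine (X : ringed_space) (U : opens X) : Prop :=
  exists A : comPzRingType, inhabited (spec_iso A U).

Record scheme := Scheme {
  scheme_space :> ringed_space;
  scheme_affine : forall x : scheme_space,
    exists2 U : opens scheme_space, opens_set U x & affine U
}.

Section Sheaves.
Context (X : ringed_space).

Record module_sheaf := ModuleSheaf {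
  msheaf :> forall U : opens X, lmodType (Osheaf U);
  mres : forall (U V : opens X) (VU : V `<=` U),
    {linear msheaf U -> msheaf V | Ores VU \; *:%R};
  mres_id : forall (U : opens X) (UU : U `<=` U) s, mres UU s = s;
  mres_comp : forall (U V W : opens X) (VU : V `<=` U) (WV : W `<=` V)
    (WU : W `<=` U) s, mres WV (mres VU s) = mres WU s;
  msheaf_axiom : sheaf_axiom (fun U V VU => mres VU : _ -> _)
}.

(* F|U is isomorphic, along e : Spec A = U, to the sheaf associated with some
   A-module M, i.e. the sheaf whose sections over each D(f) are M_f. *)
Definition is_tilde (F : module_sheaf) (A : comPzRingType) (U : opens X)
    (e : spec_iso A U) : Prop :=
  exists (M : lmodType A) (h : {linear M -> F U | iso_ring e \; *:%R}),
  forall (f : A) (V : opens X) (VU : V `<=` U),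
    V = e @` basic_open f :> set X ->
    is_module_localization f (Ores VU \o iso_ring e) (mres F VU \o h).

Definition quasi_coherent (F : module_sheaf) : Prop :=
  forall x : X, exists (U : opens X) (A : comPzRingType) (e : spec_iso A U),
    opens_set U x /\ is_tilde F e.

Definition flat_sheaf (F : module_sheaf) : Prop :=
  forall U : opens X, affine U -> flat (F U).

Record sheaf_complex := SheafComplex {
  scplx :> int -> module_sheaf;
  sdiff : forall (i : int) (U : opens X), {linear scplx (i + 1) U -> scplx i U};
  sdiff_natural : forall (i : int) (U V : opens X) (VU : V `<=` U) s,
    mres (scplx i) VU (sdiff i U s) = sdiff i V (mres (scplx (i + 1)) VU s);
  sdiff_sdiff : forall (i : int) (U : opens X) (s : scplx (i + 1 + 1) U),
    sdiff i U (sdiff (i + 1) U s) = 0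
}.

Definition sections (F : sheaf_complex) (U : opens X) : complex (Osheaf U) :=
  @Complex _ (fun i => F i U) (fun i => sdiff F i U)
    (fun i => @sdiff_sdiff F i U).

Definition F_totally_acyclic_sheaf (F : sheaf_complex) : Prop :=
  [/\ forall i, quasi_coherent (F i), forall i, flat_sheaf (F i)
    & forall U : opens X, affine U -> F_totally_acyclic (sections F U)].

Definition affine_open_covering (c : set (opens X)) : Prop :=
  (forall U, c U -> affine U) /\ \bigcup_(U in c) (U : set X) = setT.

End Sheaves.

(* Main.v *)
(* Let R = O(U) for U affine. U is covered by finitely many D(s_j) which are also
   distinguished in members of the covering; write S_j = R_{s_j}. Two facts
   compare F(U) with the F-totally acyclic complexes on the members W_j of the
   covering, for which O(W_j) -> S_j is a localization too.
   - Exactness of F(U) can be checked after localization at the s_j.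
   - If I is an injective R-module, I embeds in the product of the I_{s_j}, so
     id_I extends to this product; restricting the extension to the factors
     makes I a direct summand of the sum of the E_j = Hom_R(S_j, I). Here E_j is
     injective over O(W_j) because O(W_j) -> S_j is flat, and
     E_j (x)_R F(U) = E_j (x)_{S_j} F(D(s_j)) = E_j (x)_{O(W_j)} F(W_j)
     is acyclic; hence so is its summand I (x)_R F(U).
   The equalities hold because a quasi-coherent sheaf on an affine open is
   determined by its module of sections. To avoid constructing I_s, its elements
   are represented by sequences, x / s^m being the germ at infinity of
   k |-> s^(k - m) x. *)
From HB Require Import structures.
Require Import Defs.
From mathcomp Require Import all_boot all_order all_algebra.
From mathcomp Require Import boolp classical_sets topology functions zify.

Set Implicit Arguments.
Unset Strict Implicit.
Unset Printing Implicit Defensive.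

Import GRing.Theory.
Local Open Scope ring_scope.

(** * Tensor products *)

Section TensorTheory.
Context (R : comPzRingType) (M N : lmodType R).
Implicit Types (m : M) (n : N) (x : tensor M N).

Definition pure m n : tensor M N := tensor_class [:: (m, n)].

Lemma tensor_class_cons m n s :
  tensor_class ((m, n) :: s) = pure m n + tensor_class s.
Proof. by rewrite [RHS]tensor_addE. Qed.

Lemma pure0l n : pure 0 n = 0.
Proof. by apply/tensor_classP; exact: tensor_rel0. Qed.

Lemma pureDl m m' n : pure (m + m') n = pure m n + pure m' n.
Proof. by rewrite [RHS]tensor_addE; apply/tensor_classP/tensor_relDl. Qed.

Lemma pureDr m n n' : pure m (n + n') = pure m n + pure m n'.
Proof. by rewrite [RHS]tensor_addE; apply/tensor_classP/tensor_relDr. Qed.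

Lemma pureZl a m n : pure (a *: m) n = a *: pure m n.
Proof. by rewrite [RHS]tensor_scaleE. Qed.

Lemma pureZr a m n : pure m (a *: n) = a *: pure m n.
Proof. by rewrite -pureZl; apply/esym/tensor_classP/tensor_relZ. Qed.

Lemma pure0r m : pure m 0 = 0.
Proof. by rewrite -(scale0r (0 : N)) pureZr scale0r. Qed.

Lemma tensor_indD (P : tensor M N -> Prop) :
  P 0 -> (forall m n x, P x -> P (pure m n + x)) -> forall x, P x.
Proof.
move=> P0 PD; elim/tensor_ind; elim=> [//|[m n] s Ps].
by rewrite tensor_class_cons; exact: PD.
Qed.

(** [K] is a subgroup of [Z], and [b] is bilinear and balanced only modulo [K]; arguing with [K]
    avoids forming [Z / K]. It is used with [K] zero for [tensor_lift], and with [K] the eventually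
    zero sequences for localizations. *)
Lemma tensor_rel_sum (Z : zmodType) (K : Z -> Prop) (b : M -> N -> Z) :
    K 0 -> (forall u v, K u -> K v -> K (u - v)) ->
    (forall n, K (b 0 n)) ->
    (forall m m' n, K (b (m + m') n - (b m n + b m' n))) ->
    (forall m n n', K (b m (n + n') - (b m n + b m n'))) ->
    (forall a m n, K (b (a *: m) n - b m (a *: n))) ->
  forall s t, tensor_rel s t ->
    K (\sum_(p <- s) b p.1 p.2 - \sum_(p <- t) b p.1 p.2).
Proof.
move=> K0 KB b0 bDl bDr bZ.
have KN u : K u -> K (- u) by move=> Ku; rewrite -[- u]add0r; exact: KB.
have KD u v : K u -> K v -> K (u + v).
  by move=> Ku Kv; rewrite -[v]opprK; apply: KB => //; exact: KN.
move=> s t; elim=> {s t} [s|s t _ st|s t u _ st _ tu|s s' t t' _ ss' _ tt'|s t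
  |n|m m' n|m n n'|a m n].
- by rewrite subrr.
- by rewrite -opprB; exact: KN.
- by rewrite -(subrKA (\sum_(p <- t) b p.1 p.2)); exact: KD.
- by rewrite !big_cat /= opprD addrACA; exact: KD.
- by rewrite !big_cat /= [X in _ - X]addrC subrr.
- by rewrite big_seq1 big_nil subr0; exact: b0.
- by rewrite !big_cons !big_nil !addr0; exact: bDl.
- by rewrite !big_cons !big_nil !addr0; exact: bDr.
- by rewrite !big_seq1; exact: bZ.
Qed.

Section Lift.
Context (Z : zmodType) (b : M -> N -> Z).
Hypotheses (bDl : forall m m' n, b (m + m') n = b m n + b m' n)
  (bDr : forall m n n', b m (n + n') = b m n + b m n')
  (bZ : forall a m n, b (a *: m) n = b m (a *: n)).

(** The target is a mere group, so that tensor products over different rings can be compared.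
    Independence of the representative comes from the hypotheses of the section. *)
Definition tensor_lift x : Z := \sum_(p <- repr x) b p.1 p.2.

Lemma tensor_lift_class s :
  tensor_lift (tensor_class s) = \sum_(p <- s) b p.1 p.2.
Proof.
apply/subr0_eq; apply: (tensor_rel_sum (K := fun z => z = 0)) => //.
- by move=> u v -> ->; rewrite subr0.
- by move=> n; apply: (addrI (b 0 n)); rewrite -bDl !addr0.
- by move=> *; rewrite bDl subrr.
- by move=> *; rewrite bDr subrr.
- by move=> *; rewrite bZ subrr.
- exact: tensor_rel_repr.
Qed.

Lemma tensor_lift_pure m n : tensor_lift (pure m n) = b m n.
Proof. by rewrite tensor_lift_class big_seq1. Qed.

Lemma tensor_lift_is_additive : {morph tensor_lift : x y / x + y}.
Proof.
elim/tensor_ind=> s; elim/tensor_ind=> t.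
rewrite [X in tensor_lift X](tensor_addE s t) !tensor_lift_class.
by rewrite big_cat.
Qed.

Lemma tensor_lift0 : tensor_lift 0 = 0.
Proof.
by apply: (addrI (tensor_lift 0)); rewrite -tensor_lift_is_additive !addr0.
Qed.

End Lift.
End TensorTheory.

Section TensorMapTheory.
Context (R : comPzRingType) (M N N' : lmodType R) (f : {linear N -> N'}).
Implicit Types x y : tensor M N.

Lemma tensor_map_pure (m : M) n : tensor_map f (pure m n) = pure m (f n).
Proof. exact: tensor_mapE. Qed.

Lemma tensor_map0 : tensor_map f (0 : tensor M N) = 0.
Proof. exact: linear0. Qed.

Lemma tensor_mapD x y : tensor_map f (x + y) = tensor_map f x + tensor_map f y.
Proof. exact: linearD. Qed.

End TensorMapTheory.

Section TensorMapLeft.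
Context (R : comPzRingType) (M M' N : lmodType R) (u : {linear M -> M'}).

Definition tensor_mapl : tensor M N -> tensor M' N :=
  tensor_lift (fun m n => pure (u m) n).

Lemma tensor_mapl_pure m n : tensor_mapl (pure m n) = pure (u m) n.
Proof.
apply: tensor_lift_pure => *; first by rewrite linearD pureDl.
  by rewrite pureDr.
by rewrite linearZ pureZl pureZr.
Qed.

Lemma tensor_mapl_is_additive : {morph tensor_mapl : x y / x + y}.
Proof.
apply: tensor_lift_is_additive => *; first by rewrite linearD pureDl.
  by rewrite pureDr.
by rewrite linearZ pureZl pureZr.
Qed.

Lemma tensor_mapl_is_linear : linear tensor_mapl.
Proof.
move=> a x y; rewrite tensor_mapl_is_additive; congr (_ + _).
elim/tensor_indD: x => [|m n x IH].
  rewrite scaler0; apply/esym; rewrite -[tensor_mapl 0](addrK (tensor_mapl 0)).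
  by rewrite -tensor_mapl_is_additive addr0 subrr scaler0.
rewrite scalerDr -pureZl !tensor_mapl_is_additive scalerDr IH.
by rewrite !tensor_mapl_pure linearZ pureZl.
Qed.

HB.instance Definition _ :=
  GRing.isLinear.Build R (tensor M N) (tensor M' N) _ tensor_mapl
    tensor_mapl_is_linear.

Lemma tensor_mapl0 : tensor_mapl 0 = 0.
Proof. exact: linear0. Qed.

Lemma tensor_maplD x y : tensor_mapl (x + y) = tensor_mapl x + tensor_mapl y.
Proof. exact: linearD. Qed.

End TensorMapLeft.

Lemma tensor_map_mapl (R : comPzRingType) (M M' N N' : lmodType R)
    (u : {linear M -> M'}) (f : {linear N -> N'}) (x : tensor M N) :
  tensor_map f (tensor_mapl u x) = tensor_mapl u (tensor_map f x).
Proof.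
elim/tensor_indD: x => [|m n x IH].
  by rewrite tensor_map0 !tensor_mapl0 tensor_map0.
rewrite tensor_maplD !tensor_mapD tensor_maplD IH.
by rewrite !(tensor_mapl_pure, tensor_map_pure).
Qed.

(** Restriction of scalars along [phi]: an alias of [E] whose name records [phi], so that the
    [R]-action can be declared on it beside the [S]-action on [E]. *)
Definition restr (R S : comPzRingType) (phi : {rmorphism R -> S})
  (E : lmodType S) : Type := E.

Section Restriction.
Context (R S : comPzRingType) (phi : {rmorphism R -> S}) (E : lmodType S).

HB.instance Definition _ := GRing.Zmodule.copy (restr phi E) E.

Definition restr_scale (r : R) (e : restr phi E) : restr phi E := phi r *: (e : E).

Lemma restr_scaleA a b e :
  restr_scale a (restr_scale b e) = restr_scale (a * b) e.
Proof. by rewrite /restr_scale scalerA rmorphM. Qed.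

Lemma restr_scale1 : left_id 1 restr_scale.
Proof. by move=> e; rewrite /restr_scale rmorph1 scale1r. Qed.

Lemma restr_scaleDr : right_distributive restr_scale +%R.
Proof. by move=> a e e'; rewrite /restr_scale scalerDr. Qed.

Lemma restr_scaleDl e : {morph restr_scale^~ e : a b / a + b}.
Proof. by move=> a b; rewrite /restr_scale rmorphD scalerDl. Qed.

HB.instance Definition _ := GRing.Zmodule_isLmodule.Build R (restr phi E)
  restr_scaleA restr_scale1 restr_scaleDr restr_scaleDl.

Lemma restrE (r : R) (e : restr phi E) : r *: e = phi r *: (e : E) :> E.
Proof. by []. Qed.

End Restriction.

(** * Localization *)

(** When [phi] exhibits [S] as [R_f], [phi f] is a unit and acts bijectively on [N], so these two
    clauses say that [N] is [M_f]. *)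
Definition is_localization (R S : comPzRingType) (f : R) (phi : R -> S)
    (M : lmodType R) (N : lmodType S) (h : M -> N) : Prop :=
  (forall m, h m = 0 -> exists k, f ^+ k *: m = 0) /\
  (forall n, exists m k, phi (f ^+ k) *: n = h m).

Section TensorLocalization.
Context (R S : comPzRingType) (phi : {rmorphism R -> S}) (f : R).
Context (phi_loc : is_ring_localization f phi).
Context (M : lmodType R) (N : lmodType S) (h : {linear M -> N | phi \; *:%R}).
Context (h_loc : is_localization f phi h) (E : lmodType S).

Definition tensor_cmp : tensor (restr phi E) M -> tensor E N :=
  tensor_lift (fun (e : restr phi E) m => pure (e : E) (h m)).

Let hZ a m : h (a *: m) = phi a *: h m.
Proof. exact: linearZ_LR. Qed.

Let cmp_axioms :
  [/\ forall (e e' : restr phi E) m, pure ((e + e' : restr phi E) : E) (h m) =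
        pure (e : E) (h m) + pure (e' : E) (h m),
      forall (e : E) m m', pure e (h (m + m')) = pure e (h m) + pure e (h m')
    & forall a (e : restr phi E) m, pure (a *: e : E) (h m) =
        pure (e : E) (h (a *: m))].
Proof.
split=> *; first exact: pureDl.
  by rewrite linearD pureDr.
by rewrite restrE pureZl -pureZr hZ.
Qed.

Lemma tensor_cmp_pure (e : E) m :
  tensor_cmp (pure (e : restr phi E) m) = pure e (h m).
Proof. by case: cmp_axioms => *; exact: tensor_lift_pure. Qed.

Lemma tensor_cmpD : {morph tensor_cmp : x y / x + y}.
Proof. by case: cmp_axioms => *; exact: tensor_lift_is_additive. Qed.

Lemma tensor_cmp0 : tensor_cmp 0 = 0.
Proof. by case: cmp_axioms => *; exact: tensor_lift0. Qed.

(** The inverse sends [e (x) m / f^k] to [f^-k e (x) m], the denominator being moved to the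
    [S]-module [E]. *)
Lemma tensor_cmp_bij : bijective tensor_cmp.
Proof.
have [[u fu] phi_surj phi_ker] := phi_loc; have [h_ker h_surj] := h_loc.
have fuX k : phi (f ^+ k) * u ^+ k = 1 by rewrite rmorphXn -exprMn fu expr1n.
(* [u] is the inverse of [phi f], so [q e k m] is the intended image of [e (x) m / f^k]. *)
pose q (e : E) k m : tensor (restr phi E) M :=
  pure (u ^+ k *: e : restr phi E) m.
have q_shift e k j m : q e k m = q e (k + j)%N (f ^+ j *: m).
  rewrite /q pureZr -pureZl; congr pure.
  by rewrite restrE scalerA addnC exprD mulrA fuX mul1r.
(* Two fractions equal in [N] have numerators which agree in [M] after multiplication by
   [f^(l + k')] and [f^(l + k)]. *)
have q_uniq e n k m k' m' : phi (f ^+ k) *: n = h m ->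
    phi (f ^+ k') *: n = h m' -> q e k m = q e k' m'.
  move=> hm hm'.
  have /h_ker[l] : h (f ^+ k' *: m - f ^+ k *: m') = 0.
    by rewrite linearB /= !hZ -hm -hm' !scalerA mulrC subrr.
  rewrite scalerBr => /subr0_eq; rewrite !scalerA -!exprD => mm'.
  rewrite (q_shift e k (l + k')%N) (q_shift e k' (l + k)%N) mm'.
  by congr q; rewrite addnCA [RHS]addnCA [(k + k')%N]addnC.
have [num numP] := choice h_surj; have [den denP] := choice numP.
pose inv : tensor E N -> tensor (restr phi E) M :=
  tensor_lift (fun e n => q e (den n) (num n)).
have invP e n k m : phi (f ^+ k) *: n = h m -> q e (den n) (num n) = q e k m.
  exact: q_uniq.
have qDl k m e e' : q (e + e') k m = q e k m + q e' k m.
  by rewrite /q scalerDr [LHS]pureDl.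
have qDr k m m' e : q e k (m + m') = q e k m + q e k m'.
  by rewrite /q pureDr.
have bDr e n n' : q e (den (n + n')) (num (n + n')) =
    q e (den n) (num n) + q e (den n') (num n').
  rewrite (q_shift e (den n) (den n')) (q_shift e (den n') (den n)).
  rewrite [X in _ + q _ X _]addnC -qDr; apply: invP.
  by rewrite [RHS]linearD /= !hZ -!denP !scalerA scalerDr -!rmorphM -!exprD addnC.
(* Balancing over all of [S]: with [a = phi r / f^j], the element [a n] has numerator [r * num n]
   over [f^(j + den n)]. *)
have bZ a e n :
    q (a *: e) (den n) (num n) = q e (den (a *: n)) (num (a *: n)).
  have [r [j ra]] := phi_surj a.
  rewrite (@invP e (a *: n) (j + den n)%N (r *: num n)); last first.
    by rewrite hZ -denP !scalerA -ra exprD rmorphM mulrAC.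
  rewrite /q pureZr -pureZl; congr pure.
  by rewrite restrE !scalerA -ra exprD mulrACA fuX mul1r mulrC.
have inv_pure e n : inv (pure e n) = q e (den n) (num n).
  by apply: tensor_lift_pure.
have invD : {morph inv : x y / x + y} by apply: tensor_lift_is_additive.
have inv0 : inv 0 = 0 by apply: tensor_lift0.
exists inv.
- elim/tensor_indD=> [|e m x IH]; first by rewrite tensor_cmp0.
  rewrite tensor_cmpD invD IH tensor_cmp_pure inv_pure.
  rewrite (@invP _ _ 0 m) ?expr0 ?rmorph1 ?scale1r //.
  by rewrite /q expr0 scale1r.
- elim/tensor_indD=> [|e n x IH]; first by rewrite inv0 tensor_cmp0.
  rewrite invD tensor_cmpD IH inv_pure tensor_cmp_pure; congr (_ + _).
  by rewrite -denP pureZr pureZl scalerA fuX scale1r.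
Qed.

End TensorLocalization.

(** * Localization through germs of sequences, and its flatness *)

Section LocalizationSequences.
Context (R S : comPzRingType) (phi : {rmorphism R -> S}) (f : R).
Context (phi_loc : is_ring_localization f phi).

Definition eventually0 (M : zmodType) (u : nat -> M) : Prop :=
  exists k0, forall k, (k0 <= k)%N -> u k = 0.

Lemma eventually0_0 (M : zmodType) : eventually0 (0 : nat -> M).
Proof. by exists 0. Qed.

Lemma eventually0B (M : zmodType) (u v : nat -> M) :
  eventually0 u -> eventually0 v -> eventually0 (u - v).
Proof.
move=> [k uk] [l vl]; exists (maxn k l) => j; rewrite geq_max => /andP[kj lj].
by rewrite -[LHS]/(u j - v j) uk// vl// subr0.
Qed.

Lemma eventually0Z (A : pzRingType) (M : lmodType A) (u : nat -> A) (m : M) :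
  eventually0 u -> eventually0 (fun k => u k *: m).
Proof. by move=> [k uk]; exists k => j kj; rewrite uk// scale0r. Qed.

(* [q b] is the sequence of the numerators of [f ^+ k * b], which exist for k
   large; this describes S as a submodule of the sequences modulo the
   eventually zero ones. *)
Lemma localization_sequence : exists q : S -> nat -> R,
  [/\ forall b b', eventually0 (q (b + b') - (q b + q b')),
      forall a b, eventually0 (q (phi a * b) - a *: (q b : nat -> R^o))
    & eventually0 (q 1 - GRing.exp f)].
Proof.
have [_ phi_surj phi_ker] := phi_loc.
have [num numP] := choice phi_surj; have [den denP] := choice numP.
(* For [k < den b] the subtraction truncates and the value is meaningless; only large [k] matter. *)
pose q b k := f ^+ (k - den b) * num b.
(* Any fraction [a / f^n] for [b] gives the same germ: [l] kills the difference of cross products,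
   and from [l + n + den b] on no subtraction truncates. *)
have qP b n a : phi (f ^+ n) * b = phi a ->
    eventually0 (fun k => q b k - f ^+ (k - n) * a).
  move=> ba; have /phi_ker[l fl] : phi (f ^+ n * num b - f ^+ den b * a) = 0.
    by rewrite rmorphB !rmorphM -denP -ba mulrCA subrr.
  exists (l + (n + den b))%N => k kl; rewrite /q.
  have -> : (k - den b = k - (l + (n + den b)) + l + n)%N by lia.
  have -> : (k - n = k - (l + (n + den b)) + l + den b)%N by lia.
  by rewrite !exprD -!mulrA -!mulrBr fl mulr0.
exists q; split=> [b b'|a b|].
- have [k0 qk0] : eventually0 (fun k => q (b + b') k -
      f ^+ (k - (den b + den b')) * (f ^+ den b' * num b + f ^+ den b * num b')).
    apply: qP; rewrite rmorphD !rmorphM -!denP exprD rmorphM mulrDr !mulrA.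
    by congr (_ * _ + _); rewrite mulrC.
  exists (maxn k0 (den b + den b')) => k; rewrite geq_max => /andP[k0k dk].
  rewrite -[LHS]/(q (b + b') k - (q b k + q b' k)) -[RHS](qk0 k k0k).
  congr (_ - _); rewrite mulrDr !mulrA -!exprD /q.
  by congr (_ ^+ _ * _ + _ ^+ _ * _); lia.
- have [k0 qk0] : eventually0 (fun k =>
      q (phi a * b) k - f ^+ (k - den b) * (a * num b)).
    by apply: qP; rewrite rmorphM -denP mulrCA.
  exists k0 => k /qk0 <-.
  by rewrite -[LHS]/(q (phi a * b) k - a * q b k) /q mulrCA.
- have [k0 qk0] : eventually0 (fun k => q 1 k - f ^+ (k - 0) * 1).
    by apply: qP; rewrite expr0 rmorph1 mulr1.
  by exists k0 => k /qk0 <-; rewrite subn0 mulr1.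
Qed.

(** The pairing of [c] and [n] to the sequence [q c k *: n] is bilinear and balanced up to
    eventually zero sequences, hence detects zero tensors; at [c = 1] it is eventually
    [f ^+ k *: n]. *)
Lemma pure1_eq0 (N : lmodType R) (n : N) :
  pure (1 : restr phi S^o) n = 0 -> exists k, f ^+ k *: n = 0.
Proof.
have [q [qD qZ q1]] := localization_sequence.
move=> /tensor_classP n0.
pose b (c : restr phi S^o) (n : N) : nat -> N := fun k => q c k *: n.
have b0 (c : restr phi S^o) n' : eventually0 (q c) -> eventually0 (b c n').
  exact: eventually0Z.
have := tensor_rel_sum (K := @eventually0 N) (b := b) (@eventually0_0 N)
  (@eventually0B N) _ _ _ _ n0; rewrite big_seq1 big_nil subr0 /=.
have [k1 q1k] := q1 => -[|m m' n'|m n' n''|a m n'|k0 bk0].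
(* [qZ] with both arguments 0 says that [q 0] is eventually zero. *)
- move=> n'; apply: b0; have [k0 qk0] := qZ 0 0.
  exists k0 => k /qk0; rewrite rmorph0 mul0r scale0r => /subr0_eq.
  by [].
- have [k0 qk0] := qD m m'; exists k0 => k /qk0 qk.
  by rewrite -[LHS]/(q (m + m') k *: n' - (q m k *: n' + q m' k *: n'))
    -scalerDl -scalerBl [_ - _]qk scale0r.
- exists 0%N => k _.
  by rewrite -[LHS]/(q m k *: (n' + n'') - (q m k *: n' + q m k *: n''))
    scalerDr subrr.
- have [k0 qk0] := qZ a m; exists k0 => k /qk0 qk.
  rewrite -[LHS]/(q (phi a * m) k *: n' - q m k *: (a *: n')).
  by rewrite scalerA [q m k * a]mulrC -scalerBl [_ - _]qk scale0r.
exists (maxn k0 k1).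
rewrite -[RHS](bk0 (maxn k0 k1)) ?leq_maxl// /b.
by congr (_ *: _); apply/esym/subr0_eq/q1k; rewrite leq_maxr.
Qed.

(** By common denominators every tensor is [u^k (x) n]. If its image vanishes, multiplying by [f^k]
    leaves [1 (x) i n = 0], so [pure1_eq0] and injectivity of [i] give [f^l n = 0], and
    [u^k (x) n = u^(k + l) (x) f^l n = 0]. *)
Lemma localization_flat (N N' : lmodType R) (i : {linear N -> N'}) :
  injective i -> injective (tensor_map (M := restr phi S^o) i).
Proof.
have [[u fu] phi_surj phi_ker] := phi_loc.
have fuX k : phi (f ^+ k) * u ^+ k = 1 by rewrite rmorphXn -exprMn fu expr1n.
move=> i_inj.
have shift k l (n : N) :
    pure (u ^+ k : restr phi S^o) n =
    pure (u ^+ (k + l) : restr phi S^o) (f ^+ l *: n).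
  rewrite pureZr -pureZl restrE; congr pure.
  by rewrite -[RHS]/(phi (f ^+ l) * u ^+ (k + l)) addnC exprD mulrA fuX mul1r.
have form (x : tensor (restr phi S^o) N) :
    exists k n, x = pure (u ^+ k : restr phi S^o) n.
  elim/tensor_indD: x => [|b n _ [k [n' ->]]].
    by exists 0%N, 0; rewrite pure0r.
  have [a [j ba]] := phi_surj b.
  exists (j + k)%N, (f ^+ k *: (a *: n) + f ^+ j *: n').
  rewrite pureDr -shift [(j + k)%N]addnC -shift; congr (_ + _).
  rewrite pureZr -pureZl; congr pure.
  by rewrite restrE -[RHS]/(phi a * u ^+ j) -ba mulrAC fuX mul1r.
have ker x : tensor_map (M := restr phi S^o) i x = 0 -> x = 0.
  have [k [n ->]] := form x; rewrite tensor_map_pure => /(congr1 ( *:%R (f ^+ k))).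
  rewrite scaler0 -pureZl restrE.
  rewrite -[X in pure X _]/(phi (f ^+ k) * u ^+ k) fuX => /pure1_eq0[l].
  rewrite -linearZ -(linear0 i) => /i_inj fn.
  by rewrite (shift k l) fn pure0r.
move=> x y xy; apply/subr0_eq/ker.
by rewrite linearB; apply/eqP; rewrite subr_eq0; apply/eqP.
Qed.

End LocalizationSequences.

(** * Coinduced modules *)

Section Coinduced.
Context (R S : comPzRingType) (phi : {rmorphism R -> S}) (I : lmodType R).

Definition restr_linear : {pred S -> I} := fun u =>
  `[< forall r b c, u (phi r * b + c) = r *: u b + u c >].

Lemma restr_linearP u : reflect
  (forall r b c, u (phi r * b + c) = r *: u b + u c) (u \in restr_linear).
Proof. exact: asboolP. Qed.

Lemma restr_linear_zmod_closed : zmod_closed restr_linear.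
Proof.
split=> [|u v /restr_linearP u_lin /restr_linearP v_lin].
  by apply/restr_linearP => r b c; rewrite scaler0 addr0.
apply/restr_linearP => r b c; rewrite -[LHS]/(u _ - v _) u_lin v_lin.
by rewrite opprD addrACA -scalerBr.
Qed.

HB.instance Definition _ :=
  GRing.isZmodClosed.Build (S -> I) restr_linear restr_linear_zmod_closed.

(** [Hom_R(S, I)], carved out of the functions [S -> I] to inherit their addition; [S] will act by
    [(a u)(b) = u(b a)]. *)
Record coind := Coind { coind_fun :> S -> I; _ : coind_fun \in restr_linear }.

HB.instance Definition _ := [isSub for coind_fun].
HB.instance Definition _ := [Choice of coind by <:].
HB.instance Definition _ := [SubChoice_isSubZmodule of coind by <:].

Lemma coind_lin (u : coind) r b c : u (phi r * b + c) = r *: u b + u c.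
Proof. by case: u => u /= /restr_linearP ->. Qed.

Lemma coindD (u : coind) b c : u (b + c) = u b + u c.
Proof. by have := coind_lin u 1 b c; rewrite rmorph1 mul1r scale1r. Qed.

Lemma coind0 (u : coind) : u 0 = 0.
Proof. by apply: (addrI (u 0)); rewrite -coindD !addr0. Qed.

Lemma coindZ (u : coind) r b : u (phi r * b) = r *: u b.
Proof. by rewrite -[LHS]/(u _) -[phi r * b]addr0 coind_lin coind0 addr0. Qed.

Lemma coind_ext (u v : coind) : u =1 v -> u = v.
Proof. by move=> uv; apply/val_inj/funext. Qed.

Lemma coind_scale_subproof (a : S) (u : coind) :
  (fun b => u (b * a)) \in restr_linear.
Proof. by apply/restr_linearP => r b c; rewrite mulrDl -mulrA coind_lin. Qed.

Definition coind_scale a u := Coind (coind_scale_subproof a u).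

Lemma coind_scaleA a b u : coind_scale a (coind_scale b u) = coind_scale (a * b) u.
Proof. by apply: coind_ext => c /=; rewrite mulrA. Qed.

Lemma coind_scale1 : left_id 1 coind_scale.
Proof. by move=> u; apply: coind_ext => c /=; rewrite mulr1. Qed.

Lemma coind_scaleDr : right_distributive coind_scale +%R.
Proof. by move=> a u v; apply: coind_ext. Qed.

Lemma coind_scaleDl u : {morph coind_scale^~ u : a b / a + b}.
Proof. by move=> a b; apply: coind_ext => c; rewrite /= mulrDr coindD. Qed.

HB.instance Definition _ := GRing.Zmodule_isLmodule.Build S coind
  coind_scaleA coind_scale1 coind_scaleDr coind_scaleDl.

End Coinduced.

(* S (x)_R' N; phi serves to make it an R-module. *)
Definition base_change (R R' S : comPzRingType) (phi : {rmorphism R -> S})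
    (psi : {rmorphism R' -> S}) (N : lmodType R') : Type :=
  tensor (restr psi S^o) N.

Section BaseChange.
Context (R R' S : comPzRingType) (phi : {rmorphism R -> S})
  (psi : {rmorphism R' -> S}) (N : lmodType R').

Definition base_mul (r : R) (c : restr psi S^o) : restr psi S^o := phi r * c.

Lemma base_mul_is_linear r : linear (base_mul r).
Proof.
move=> a c c'; rewrite -[LHS]/(phi r * (psi a * c + c')) mulrDr.
by rewrite mulrCA.
Qed.

HB.instance Definition _ r := GRing.isLinear.Build R' (restr psi S^o)
  (restr psi S^o) _ (base_mul r) (base_mul_is_linear r).

Local Notation base_change := (base_change phi psi N).

HB.instance Definition _ := GRing.Zmodule.copy base_change
  (tensor (restr psi S^o) N).

Definition base_scale (r : R) (x : base_change) : base_change :=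
  tensor_mapl (base_mul r) x.

Lemma base_scale_pure r c n :
  base_scale r (pure (c : restr psi S^o) n) = pure (phi r * c : restr psi S^o) n.
Proof. exact: tensor_mapl_pure. Qed.

Lemma base_scaleDr : right_distributive base_scale +%R.
Proof. by move=> r x y; exact: tensor_maplD. Qed.

Lemma base_scale0r r : base_scale r 0 = 0.
Proof. exact: tensor_mapl0. Qed.

Lemma base_scaleA a b x : base_scale a (base_scale b x) = base_scale (a * b) x.
Proof.
elim/tensor_indD: x => [|c n x IH]; first by rewrite !base_scale0r.
by rewrite !base_scaleDr IH !base_scale_pure rmorphM mulrA.
Qed.

Lemma base_scale1 : left_id 1 base_scale.
Proof.
elim/tensor_indD=> [|c n x IH]; first by rewrite base_scale0r.
by rewrite base_scaleDr IH base_scale_pure rmorph1 mul1r.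
Qed.

Lemma base_scaleDl x : {morph base_scale^~ x : a b / a + b}.
Proof.
move=> a b; elim/tensor_indD: x => [|c n x IH].
  by rewrite !base_scale0r addr0.
rewrite !base_scaleDr IH !base_scale_pure rmorphD mulrDl addrACA; congr (_ + _).
exact: pureDl.
Qed.

HB.instance Definition _ := GRing.Zmodule_isLmodule.Build R base_change
  base_scaleA base_scale1 base_scaleDr base_scaleDl.

End BaseChange.

Lemma base_change_map_linear (R R' S : comPzRingType) (phi : {rmorphism R -> S})
    (psi : {rmorphism R' -> S}) (N N' : lmodType R') (i : {linear N -> N'}) :
  linear (tensor_map i : base_change phi psi N -> base_change phi psi N').
Proof.
move=> r x y; rewrite [LHS]tensor_mapD; congr (_ + _).
exact: tensor_map_mapl.
Qed.

(** By adjunction, maps [N -> Hom_R(S, I)] over [R'] are maps from the tensor product of [S] and [N]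
    over [R'] to [I] over [R]. Extending along [i] thus becomes extending along the base change of
    [i], which is injective as [S] is flat over [R']. *)
Lemma coind_injective (R R' S : comPzRingType) (phi : {rmorphism R -> S})
    (psi : {rmorphism R' -> S}) (g : R') (I : lmodType R) :
  is_ring_localization g psi -> injective_module I ->
  injective_module (restr psi (coind phi I)).
Proof.
move=> psi_loc I_inj N N' i u i_inj.
pose B := base_change phi psi.
have u_lin a n c : u (a *: n) c = u n (c * psi a).
  by rewrite linearZ.
have bDl (c c' : restr psi S^o) n : u n (c + c') = u n c + u n c'.
  exact: coindD.
have bDr (c : restr psi S^o) n n' : u (n + n') c = u n c + u n' c.
  by rewrite linearD.
have bZ a (c : restr psi S^o) n : u n (a *: c) = u (a *: n) c.
  by rewrite u_lin mulrC.
(* [v] is the adjoint of [u]; its extension [w] is turned back into [u'] below. *)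
pose v : B N -> I := tensor_lift (fun (c : restr psi S^o) n => u n c).
have v_pure c n : v (pure c n) = u n c by exact: tensor_lift_pure.
have vD x y : v (x + y) = v x + v y by exact: tensor_lift_is_additive.
have v0 : v 0 = 0 by exact: tensor_lift0.
have v_lin : linear v.
  move=> r x y; rewrite vD; congr (_ + _).
  elim/tensor_indD: x => [|c n x IH]; first by rewrite scaler0 v0 scaler0.
  rewrite scalerDr !vD IH scalerDr; congr (_ + _).
  by rewrite [X in v X]base_scale_pure !v_pure coindZ.
pose vL : {linear B N -> I} := HB.pack v (GRing.isLinear.Build _ _ _ _ v v_lin).
pose iL : {linear B N -> B N'} := HB.pack
  (tensor_map i : B N -> B N')
  (GRing.isLinear.Build _ _ _ _ (tensor_map i : B N -> B N')
     (@base_change_map_linear _ _ _ phi psi _ _ i)).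
have [w wP] := I_inj _ _ iL vL (localization_flat psi_loc i_inj).
have w_coind n' :
    (fun c : S => w (pure (c : restr psi S^o) n')) \in @restr_linear _ _ phi I.
  apply/restr_linearP => r b c; rewrite [pure _ _]pureDl linearD; congr (_ + _).
  by rewrite -linearZ; congr (w _); apply/esym/base_scale_pure.
pose u' n' : restr psi (coind phi I) := Coind (w_coind n').
have u'_lin : linear u'.
  move=> a x y; apply: coind_ext => c.
  rewrite -[LHS]/(w _) pureDr linearD; congr (_ + _).
  rewrite -[RHS]/(w (pure (c * psi a : restr psi S^o) x)).
  by rewrite pureZr -pureZl; congr (w (pure _ _)); rewrite restrE mulrC.
pose u'L : {linear N' -> restr psi (coind phi I)} :=
  HB.pack u' (GRing.isLinear.Build _ _ _ _ u' u'_lin).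
exists u'L => x.
apply: coind_ext => c.
by rewrite -[LHS]/(w _) -tensor_map_pure [LHS]wP; exact: v_pure.
Qed.

(** * Complexes *)

(** The complexes live over different rings, so the [c i] are bare functions; acyclicity only sees 0
    and the differentials. *)
Lemma acyclic_transfer (R S : comPzRingType) (C : complex R) (D : complex S)
    (c : forall i, C i -> D i) :
  (forall i, bijective (c i)) -> (forall i, c i 0 = 0) ->
  (forall i x, c i (cdiff C i x) = cdiff D i (c (i + 1) x)) ->
  acyclic C <-> acyclic D.
Proof.
move=> c_bij c0 cd; split=> acy i x dx0.
  have [c' cK c'K] := c_bij (i + 1).
  have [y dy] : exists y, cdiff C (i + 1) y = c' x.
    by apply: acy; apply: (bij_inj (c_bij i)); rewrite cd c'K dx0 c0.
  by exists (c (i + 1 + 1) y); rewrite -cd dy c'K.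
have [y dy] : exists y, cdiff D (i + 1) y = c (i + 1) x.
  by apply: acy; rewrite -cd dx0 c0.
have [c' cK c'K] := c_bij (i + 1 + 1).
by exists (c' y); apply: (bij_inj (c_bij (i + 1))); rewrite cd c'K.
Qed.

Section ComplexLocalization.
Context (R S : comPzRingType) (phi : {rmorphism R -> S}) (f : R).
Context (phi_loc : is_ring_localization f phi).
Context (C : complex R) (D : complex S).
Context (h : forall i, {linear C i -> D i | phi \; *:%R}).
Context (h_loc : forall i, is_localization f phi (h i)).
Context (h_diff : forall i x, h i (cdiff C i x) = cdiff D i (h (i + 1) x)).

Let hZ i a (m : C i) : h i (a *: m) = phi a *: h i m.
Proof. exact: linearZ_LR. Qed.

Lemma acyclic_tensor_localization (E : lmodType S) :
  acyclic (tensor_complex (restr phi E) C) <-> acyclic (tensor_complex E D).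
Proof.
apply: (acyclic_transfer (C := tensor_complex (restr phi E) C)
  (D := tensor_complex E D)
  (c := fun i => @tensor_cmp _ _ phi _ _ (h i) E)) => [i|i|i x] /=.
- exact: (tensor_cmp_bij phi_loc (h_loc i)).
- exact: (tensor_cmp0 (h i) E).
- elim/tensor_indD: x => [|e m x IH].
    by rewrite tensor_map0 !tensor_cmp0 tensor_map0.
  rewrite tensor_mapD !tensor_cmpD tensor_mapD IH tensor_map_pure.
  by rewrite !tensor_cmp_pure tensor_map_pure h_diff.
Qed.

Lemma acyclic_localization : acyclic C -> acyclic D.
Proof.
move=> acy i x dx0; have [[u fu] _ _] := phi_loc.
have fuX k : phi (f ^+ k) * u ^+ k = 1 by rewrite rmorphXn -exprMn fu expr1n.
have [h_ker _] := h_loc i; have [_ h_surj] := h_loc (i + 1).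
have [m [k xm]] := h_surj x.
have /h_ker[l] : h i (cdiff C i m) = 0 by rewrite h_diff -xm linearZ /= dx0 scaler0.
rewrite -linearZ => /acy[y dy].
exists (u ^+ (l + k) *: h (i + 1 + 1) y).
rewrite linearZ /= -h_diff dy hZ -xm !scalerA -rmorphM -exprD.
by rewrite mulrC fuX scale1r.
Qed.

(** A primitive of the image of [x] in [D] is [y / f^k]; then [f^k x - d y] dies in [D], hence is
    killed by some [f^l]. *)
Lemma locally_boundary i (x : C (i + 1)) :
  acyclic D -> cdiff C i x = 0 ->
  exists k, exists y, cdiff C (i + 1) y = f ^+ k *: x.
Proof.
move=> acy dx0; have [[u fu] _ _] := phi_loc.
have [_ h_surj] := h_loc (i + 1 + 1); have [h_ker _] := h_loc (i + 1).
have [y' dy'] : exists y', cdiff D (i + 1) y' = h (i + 1) x.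
  by apply: acy; rewrite -h_diff dx0 linear0.
have [y [k yy']] := h_surj y'.
have /h_ker[l] : h (i + 1) (f ^+ k *: x - cdiff C (i + 1) y) = 0.
  by rewrite linearB /= hZ h_diff -yy' linearZ /= dy' subrr.
rewrite scalerBr scalerA -exprD => /subr0_eq dy.
by exists (l + k)%N, (f ^+ l *: y); rewrite linearZ dy.
Qed.

Section Retract.
Context (I : lmodType R) (T : {linear (nat -> I) -> I}).
Context (T0 : forall u, eventually0 u -> T u = 0).

Let Teq u v : eventually0 (u - v) -> T u = T v.
Proof. by move=> /T0; rewrite linearB => /subr0_eq. Qed.

(* theta factors through Hom_R(S, I). *)
Lemma tensor_boundary_of_coind (theta : {linear I -> I}) i
    (z : tensor I (C (i + 1))) :
  (forall x, theta x = T (fun k => f ^+ k *: x)) ->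
  acyclic (tensor_complex (restr phi (coind phi I)) C) ->
  tensor_map (cdiff C i) z = 0 ->
  exists y, tensor_map (cdiff C (i + 1)) y = tensor_mapl theta z.
Proof.
move=> thetaE acy dz0; pose E := restr phi (coind phi I).
have [q [qD qZ [k1 q1]]] := localization_sequence phi_loc.
(* [T] acts as a map from the localization of [I] at [f] to [I], and [t x] is [b |-> T (b x)].
   Evaluation at 1 after [sigma] is [theta], because [q 1] is eventually [f ^+ k]. *)
pose t x b := T (fun k => q b k *: x).
have t_coind x : t x \in @restr_linear _ _ phi I.
  apply/restr_linearP => r b c; rewrite /t -linearP; apply: Teq.
  have [[kD qDk] [kZ qZk]] := (qD (phi r * b) c, qZ r b).
  exists (maxn kD kZ) => k; rewrite geq_max => /andP[/qDk qDk' /qZk qZk'].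
  rewrite -[LHS]/(q (phi r * b + c) k *: x - (r *: (q b k *: x) + q c k *: x)).
  have -> : q (phi r * b + c) k = q (phi r * b) k + q c k := subr0_eq qDk'.
  have -> : q (phi r * b) k = r * q b k := subr0_eq qZk'.
  by rewrite scalerDl scalerA subrr.
pose sigma x : E := Coind (t_coind x).
have sigma_lin : linear sigma.
  move=> a x y; apply: coind_ext => b.
  rewrite -[RHS]/(sigma x (b * phi a) + t y b) mulrC coindZ -[RHS]linearP.
  congr (T _); apply/funext => k.
  rewrite -[RHS]/(a *: (q b k *: x) + q b k *: y).
  by rewrite scalerDr !scalerA mulrC.
pose ev (u : E) : I := (u : coind phi I) 1.
have ev_lin : linear ev.
  move=> a u v; rewrite -[LHS]/(u (1 * phi a) + v 1) mulrC coindZ.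
  by [].
pose sigmaL : {linear I -> E} :=
  HB.pack sigma (GRing.isLinear.Build _ _ _ _ sigma sigma_lin).
pose evL : {linear E -> I} :=
  HB.pack ev (GRing.isLinear.Build _ _ _ _ ev ev_lin).
(* [sigma] takes [z] to a cycle of an acyclic complex; [ev] then takes a primitive of it to a
   primitive of [theta z]. *)
have [w dw] := acy i (tensor_mapl sigmaL z) (etrans (tensor_map_mapl _ _ _)
  (etrans (congr1 (tensor_mapl sigmaL) dz0) (tensor_mapl0 _ _))).
exists (tensor_mapl evL w); rewrite tensor_map_mapl [X in tensor_mapl _ X]dw.
elim/tensor_indD: {dz0 w dw} z => [|m n x IH]; first by rewrite !tensor_mapl0.
rewrite !tensor_maplD IH !tensor_mapl_pure; congr (pure _ _ + _).
rewrite thetaE; apply: Teq; exists k1 => k /q1 q1k.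
by rewrite -[LHS]/(q 1 k *: m - f ^+ k *: m) -scalerBl [_ - _]q1k scale0r.
Qed.

End Retract.
End ComplexLocalization.

(** * Gluing along generators of the unit ideal *)

Lemma ideal_pow_span (R : comPzRingType) (J : R -> Prop) n (a s : 'I_n -> R) :
  J 0 -> (forall x y, J x -> J y -> J (x + y)) ->
  (forall x y, J y -> J (x * y)) ->
  \sum_i a i * s i = 1 -> (forall i, exists k, J (s i ^+ k)) -> J 1.
Proof.
move=> J0 JD JM as1 Js.
(* The elements with a power in [J] are closed under sums and multiples, so the combination equal to
   1 is one of them. *)
suff [k] : exists k, J ((\sum_i a i * s i) ^+ k) by rewrite as1 expr1n.
apply: (big_ind (fun x => exists k, J (x ^+ k))).
- by exists 1%N.
- move=> x y [k xk] [l yl]; exists (k + l)%N; rewrite exprDn.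
  apply: big_ind => // i _; rewrite -mulr_natr mulrC; apply: (JM).
  (* In the term [x^(k + l - i) y^i], either [i >= l] or [k + l - i >= k]. *)
  have [li|il] := leqP l i.
    by rewrite -[X in y ^+ X](subnK li) exprD mulrA; exact: JM.
  have ki : (k <= k + l - i)%N by lia.
  by rewrite -[X in x ^+ X](subnK ki) exprD mulrAC; exact: JM.
- by move=> i _; have [k sk] := Js i; exists k; rewrite exprMn; exact: JM.
Qed.

Section GlueInjective.
Context (R : comPzRingType) (n : nat) (a s : 'I_n -> R).
Context (as1 : \sum_i a i * s i = 1) (I : lmodType R).

(** The pairs [(x, u)] in which each [u i] represents the image of [x] in the localization of [I] at
    [s i]: the diagonal copy of [I], pulled back to sequences. *)
Definition germ_pred : {pred I * ('I_n -> nat -> I)} := fun p =>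
  `[< forall i, eventually0 (p.2 i - (fun k => s i ^+ k *: p.1)) >].

Lemma germ_predP p : reflect
  (forall i, eventually0 (p.2 i - (fun k => s i ^+ k *: p.1))) (p \in germ_pred).
Proof. exact: asboolP. Qed.

Lemma germ_submod_closed : submod_closed germ_pred.
Proof.
split=> [|c p p' /germ_predP germ_p /germ_predP germ_p'].
  apply/germ_predP => i; exists 0%N => k _.
  by rewrite -[LHS]/(0 - s i ^+ k *: 0 : I) scaler0 subrr.
apply/germ_predP => i; have [k0 pk] := germ_p i; have [k0' pk'] := germ_p' i.
exists (maxn k0 k0') => k; rewrite geq_max => /andP[/pk pk0 /pk' pk0'].
rewrite -[LHS]/(c *: p.2 i k + p'.2 i k - s i ^+ k *: (c *: p.1 + p'.1)).
rewrite (subr0_eq pk0) (subr0_eq pk0') scalerDr !scalerA mulrC.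
by rewrite subrr.
Qed.

HB.instance Definition _ := GRing.isSubmodClosed.Build R
  (I * ('I_n -> nat -> I))%type germ_pred germ_submod_closed.

Record germ := Germ {
  germ_val : I * ('I_n -> nat -> I);
  _ : germ_val \in germ_pred
}.

HB.instance Definition _ := [isSub for germ_val].
HB.instance Definition _ := [Choice of germ by <:].
HB.instance Definition _ := [SubChoice_isSubZmodule of germ by <:].
HB.instance Definition _ := [SubZmodule_isSubLmodule of germ by <:].

(** The annihilator of [x] is an ideal containing a power of each [s i]. This is the injectivity of
    [I] into the product of its localizations. *)
Lemma pow_torsion0 (x : I) : (forall i, exists k, s i ^+ k *: x = 0) -> x = 0.
Proof.
move=> sx; rewrite -[x]scale1r.
apply: (ideal_pow_span (J := fun r => r *: x = 0) _ _ _ as1 sx).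
- exact: scale0r.
- by move=> b c bx cx; rewrite scalerDl bx cx addr0.
- by move=> b c cx; rewrite -scalerA cx scaler0.
Qed.

(* T is a retraction of the diagonal of I into the product of its
   localizations at the s i, lifted to sequences. *)
Lemma injective_glue : injective_module I ->
  exists T : {linear ('I_n -> nat -> I) -> I}, forall u x,
    (forall i, eventually0 (u i - (fun k => s i ^+ k *: x))) -> T u = x.
Proof.
move=> I_inj.
pose v (g : germ) := (germ_val g).2; pose w (g : germ) := (germ_val g).1.
have v_lin : linear v by [].
have w_lin : linear w by [].
pose vL : {linear germ -> ('I_n -> nat -> I)} :=
  HB.pack v (GRing.isLinear.Build _ _ _ _ v v_lin).
pose wL : {linear germ -> I} :=
  HB.pack w (GRing.isLinear.Build _ _ _ _ w w_lin).
have v_inj : injective v.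
  move=> [[x u] xu] [[x' u'] xu']; rewrite /v /= => uu'; apply: val_inj => /=.
  rewrite -{u'}uu' in xu' *; congr (_, _); apply/subr0_eq/pow_torsion0 => i.
  have [k0 xk] := elimT (germ_predP _) xu i.
  have [k0' xk'] := elimT (germ_predP _) xu' i.
  exists (maxn k0 k0'); rewrite scalerBr.
  rewrite -(subr0_eq (xk _ (leq_maxl _ _))) -(subr0_eq (xk' _ (leq_maxr _ _))).
  by rewrite subrr.
(* The projection to [I] extends along the projection to sequences, injective by [pow_torsion0]. *)
have [T TP] := I_inj _ _ vL wL v_inj; exists T => u x ux.
have xu : (x, u) \in germ_pred by apply/germ_predP.
exact: (TP (Germ xu)).
Qed.

End GlueInjective.

Section Glue.
Context (R : comPzRingType) (C : complex R) (n : nat) (a s : 'I_n -> R).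
Context (as1 : \sum_i a i * s i = 1).

(** For a cycle [x], the scalars [r] such that [r x] is a boundary form an ideal. *)
Lemma acyclic_glue :
  (forall j i (x : C (i + 1)), cdiff C i x = 0 ->
     exists k, exists y, cdiff C (i + 1) y = s j ^+ k *: x) ->
  acyclic C.
Proof.
move=> Cs i x dx0.
have [] // : exists y, cdiff C (i + 1) y = 1 *: x; last first.
  by move=> y dy; exists y; rewrite dy scale1r.
apply: (ideal_pow_span (J := fun r => exists y, cdiff C (i + 1) y = r *: x)
  _ _ _ as1) => [|b c [y yb] [y' yc]|b c [y yc]|j].
- by exists 0; rewrite linear0 scale0r.
- by exists (y + y'); rewrite linearD yb yc scalerDl.
- by exists (b *: y); rewrite linearZ yc /= scalerA.
- exact: Cs.
Qed.

(** Restricting the retraction of [injective_glue] to its factors gives endomorphisms [theta j] of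
    [I] with sum the identity, so [z] is a sum of boundaries [theta j z]. *)
Lemma acyclic_tensor_glue (I : lmodType R) : injective_module I ->
  (forall j (T : {linear (nat -> I) -> I}) (theta : {linear I -> I}),
     (forall u, eventually0 u -> T u = 0) ->
     (forall x, theta x = T (fun k => s j ^+ k *: x)) ->
     forall i (z : tensor I (C (i + 1))), tensor_map (cdiff C i) z = 0 ->
     exists y, tensor_map (cdiff C (i + 1)) y = tensor_mapl theta z) ->
  acyclic (tensor_complex I C).
Proof.
move=> I_inj Is i z dz0; have [T TP] := injective_glue as1 I_inj.
pose single j u : 'I_n -> nat -> I := fun j' => if j' == j then u else 0.
have T_lin j : linear (T \o single j).
  move=> c u v; rewrite /= -linearP; congr (T _); apply/funext => j'.
  rewrite -[RHS]/(c *: single j u j' + single j v j') /single.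
  by case: eqP => // _; rewrite scaler0 addr0.
pose TL j : {linear (nat -> I) -> I} :=
  HB.pack (T \o single j) (GRing.isLinear.Build _ _ _ _ _ (T_lin j)).
have T0 j u : eventually0 u -> TL j u = 0.
  move=> [k0 uk]; apply: TP => j'; exists k0 => k /uk uk0.
  rewrite -[LHS]/(single j u j' k - s j' ^+ k *: 0) scaler0 subr0 /single.
  by case: eqP.
pose theta j x := TL j (fun k => s j ^+ k *: x).
have theta_lin j : linear (theta j).
  move=> c x y; rewrite /theta -linearP; congr (TL j _); apply/funext => k.
  rewrite -[RHS]/(c *: (s j ^+ k *: x) + s j ^+ k *: y).
  by rewrite scalerDr !scalerA mulrC.
pose thetaL j : {linear I -> I} :=
  HB.pack (theta j) (GRing.isLinear.Build _ _ _ _ _ (theta_lin j)).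
(* The sequences [s j ^+ k *: x], each placed in its factor, add up to the diagonal of [x]. *)
have theta_sum x : \sum_j thetaL j x = x.
  rewrite -[LHS](linear_sum T); apply: TP => j; exists 0%N => k _.
  rewrite -[LHS]/((\sum_j' _) j k - s j ^+ k *: x).
  rewrite !fct_sumE (bigD1 j) //= big1 ?addr0; last first.
    by move=> j' j'j; rewrite /single eq_sym (negbTE j'j).
  by rewrite /single eqxx subrr.
have [y yP] :=
  choice (fun j => Is j (TL j) (thetaL j) (T0 j) (fun=> erefl) i z dz0).
exists (\sum_j y j); rewrite -[LHS]/(tensor_map _ _) linear_sum /=.
under eq_bigr do rewrite yP.
elim/tensor_indD: {dz0 y yP} z => [|m p x IH].
  by rewrite big1 // => j _; rewrite tensor_mapl0.
under eq_bigr do rewrite tensor_maplD tensor_mapl_pure.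
rewrite big_split /= IH; congr (_ + _); rewrite -[in RHS](theta_sum m).
by rewrite (big_morph (fun m => pure m p) (id1 := 0) (op1 := +%R)) //
  => [m1 m2|]; rewrite (pureDl, pure0l).
Qed.

End Glue.
Local Open Scope classical_set_scope.

(** * Affine opens *)

Section PrimeIdeals.
Context (A : comPzRingType).

Definition ideal (J : set A) : Prop :=
  [/\ J 0, forall a b, J a -> J b -> J (a + b) & forall a b, J b -> J (a * b)].

Lemma prime_above (J : set A) : ideal J -> ~ J 1 -> exists p : spec A, J `<=` p.
Proof.
move=> J_ideal J1.
pose P : set (set A) := [set K | K = set0 \/ [/\ ideal K, ~ K 1 & J `<=` K]].
have [] := @Zorn_bigcup A P.
  move=> F FP F_total; have [[K0 FK0 K0n0]|F0] :=
    pselect (exists2 K, F K & K <> set0); last first.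
    left; rewrite -subset0 => x [K FK Kx]; apply: F0; exists K => // K0.
    by rewrite K0 in Kx.
  have FK_ideal K x : F K -> K x -> [/\ ideal K, ~ K 1 & J `<=` K].
    by move=> FK Kx; case: (FP K FK) => // K_0; rewrite K_0 in Kx.
  have [x0 K0x0] : exists x, K0 x by apply/set0P/eqP.
  have [[K00 K0D K0M] K01 JK0] := FK_ideal _ _ FK0 K0x0.
  right; split=> [|[K FK K1]|x /JK0]; last by exists K0.
    split; first by exists K0.
      move=> a b [K FK Ka] [K' FK' K'b].
      have [KK'|K'K] := F_total _ _ FK FK'.
        exists K' => //; have [[_ K'D _] _ _] := FK_ideal _ _ FK' K'b.
        by apply: K'D => //; exact: KK'.
      exists K => //; have [[_ KD _] _ _] := FK_ideal _ _ FK Ka.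
      by apply: KD => //; exact: K'K.
    move=> a b [K FK Kb]; exists K => //.
    by have [[_ _ KM] _ _] := FK_ideal _ _ FK Kb; exact: KM.
  by have [_ K1' _] := FK_ideal _ _ FK K1.
move=> K [PK K_max].
have {PK} [[K0 KD KM] K1 JK] : [/\ ideal K, ~ K 1 & J `<=` K].
  case: PK => // K_0; exfalso; apply: (K_max J); last by right; split.
  rewrite K_0; split; first exact: sub0set.
  by case: J_ideal => J0 _ _ /(_ 0 J0).
have K_span a : ~ K a -> exists r, K (1 - r * a).
  move=> Ka; apply: contrapT => /forallNP K_a.
  (* This set is the ideal [K + (a)]; were it proper, it would contradict the maximality of [K]. *)
  apply: (K_max [set x | exists r, K (x - r * a)]).
    split=> [x Kx|sub]; first by exists 0; rewrite mul0r subr0.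
    by apply/Ka/sub; exists 1; rewrite mul1r subrr.
  right; split=> [|[r /K_a]//|x /JK Kx]; last by exists 0; rewrite mul0r subr0.
  split; first by exists 0; rewrite mul0r subr0.
    by move=> x y [r xr] [r' yr']; exists (r + r'); rewrite mulrDl opprD addrACA;
      exact: KD.
  by move=> x y [r yr]; exists (x * r); rewrite -mulrA -mulrBr; exact: KM.
suff K_prime : prime_ideal K by exists (Spec K_prime).
split=> // a b Kab; apply: contrapT => /not_orP[/K_span[r ra] /K_span[r' rb]].
apply: K1; rewrite -(subrK (r * a) 1).
apply: (KD) => //.
rewrite -[_ * a]mulr1 -(subrK (r' * b) 1) mulrDr; apply: (KD); first exact: KM.
by rewrite mulrACA; exact: KM.
Qed.

Definition ideal_span (G : set A) : set A := [set r |
  exists l : seq (A * A), (forall p, p \in l -> G p.2) /\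
    r = \sum_(p <- l) p.1 * p.2].

Lemma ideal_span_ideal G : ideal (ideal_span G).
Proof.
split; first by exists [::]; split=> //; rewrite big_nil.
- move=> a b [l [Gl ->]] [l' [Gl' ->]]; exists (l ++ l'); rewrite big_cat.
  by split=> // p; rewrite mem_cat => /orP[/Gl|/Gl'].
- move=> a b [l [Gl ->]]; exists [seq (a * p.1, p.2) | p <- l]; split.
    by move=> _ /mapP[p pl ->]; exact: (Gl p).
  by rewrite big_map mulr_sumr; apply: eq_bigr => p _; rewrite /= mulrA.
Qed.

Lemma ideal_span_gen (G : set A) g : G g -> ideal_span G g.
Proof.
move=> Gg; exists [:: (1, g)]; rewrite big_seq1 mul1r.
by split=> // p; rewrite inE => /eqP ->.
Qed.

Lemma ideal_span1P G : ideal_span G 1 ->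
  exists n (a s : 'I_n -> A), (forall i, G (s i)) /\ \sum_i a i * s i = 1.
Proof.
move=> [l [Gl ->]]; exists (size l), (fun i => (nth 0 l i).1),
  (fun i => (nth 0 l i).2); split; last by rewrite (big_nth 0) big_mkord.
by move=> i; apply/Gl/mem_nth.
Qed.

Lemma basic_open_open (f : A) : open (basic_open f).
Proof.
exists [set f]; apply/seteqP; split=> p /= pf; last first.
  by move=> p_f; apply: pf => _ ->.
by move=> sub; exact/pf/sub.
Qed.

End PrimeIdeals.

Section Invertible.
Context (R : comPzRingType).

Definition invertible (x : R) : Prop := exists y, x * y = 1.

Lemma invertibleM x y : invertible (x * y) <-> invertible x /\ invertible y.
Proof.
split=> [[z xyz]|[[x' xx'] [y' yy']]].
  by split; [exists (y * z); rewrite mulrA|exists (x * z); rewrite mulrCA mulrA].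
by exists (x' * y'); rewrite mulrACA xx' yy' mulr1.
Qed.

Lemma invertibleX x k : invertible x -> invertible (x ^+ k).
Proof. by move=> [y xy]; exists (y ^+ k); rewrite -exprMn xy expr1n. Qed.

Lemma invertible_inj (M : lmodType R) x (m m' : M) :
  invertible x -> x *: m = x *: m' -> m = m'.
Proof.
move=> [y xy] /(congr1 ( *:%R y)).
by rewrite !scalerA mulrC xy !scale1r.
Qed.

End Invertible.

Lemma invertible_morph (R S : comPzRingType) (phi : {rmorphism R -> S}) x :
  invertible x -> invertible (phi x).
Proof. by move=> [y xy]; exists (phi y); rewrite -rmorphM xy rmorph1. Qed.

Section DistinguishedOpens.
Context (X : ringed_space).
Implicit Types U V W : opens X.

Lemma opens_eq U V : U = V :> set X -> U = V.
Proof.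
case: U V => [U oU] [V oV] /= UV; rewrite {U}UV in oU *.
by rewrite (Prop_irrelevance oU oV).
Qed.

(* V is the locus of U where s is invertible; for U = Spec A this is D(s). *)
Definition is_D U (s : Osheaf U) V : Prop :=
  V `<=` U /\ forall W (WU : W `<=` U), W `<=` V <-> invertible (Ores WU s).

Lemma is_D_uniq U s V V' : @is_D U s V -> is_D s V' -> V = V'.
Proof.
move=> [VU DV] [V'U DV']; apply/opens_eq/seteqP; split.
  exact/(DV' _ VU)/DV.
exact/(DV _ V'U)/DV'.
Qed.

Lemma is_D_restrict U s V W (WU : W `<=` U) (VW : opens X) :
  @is_D U s V -> VW = W `&` V :> set X -> is_D (Ores WU s) VW.
Proof.
move=> [VU DV] VWE; split=> [|W' W'W]; first by rewrite VWE => x [].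
rewrite (Ores_comp WU W'W (subset_trans W'W WU)) -DV VWE.
by split=> [sub x /sub[]|sub x W'x]; [|split; [exact: W'W|exact: sub]].
Qed.

(** Here [b = a / s^k] on [V = D(s)], so [a] and [b] differ there by a unit: distinguished opens of
    [V] are distinguished in [U]. *)
Lemma is_D_trans U s V (VU : V `<=` U) (b : Osheaf V) k a V' :
  is_D s V -> Ores VU s ^+ k * b = Ores VU a -> is_D b V' -> is_D (s * a) V'.
Proof.
move=> [_ DV] ba [V'V DV']; split=> [|W WU]; first exact: (subset_trans V'V VU).
have aE (WV : W `<=` V) : Ores WU a = Ores WU s ^+ k * Ores WV b.
  by rewrite -(Ores_comp VU WV WU a) -ba rmorphM rmorphXn /= (Ores_comp VU WV WU).
rewrite rmorphM invertibleM; split=> [WV'|[/DV WV]].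
  have WV := subset_trans WV' V'V.
  have s_inv : invertible (Ores WU s) by apply/DV.
  split=> //; rewrite (aE WV) invertibleM; split; first exact: invertibleX.
  exact/DV'.
by rewrite (aE WV) invertibleM => -[_ /DV'].
Qed.

Section SpecIso.
Context (A : comPzRingType) (U : opens X) (e : spec_iso A U).

Definition iso_D (f : A) : opens X := Opens (iso_open e (basic_open_open f)).

Lemma iso_D_sub f : iso_D f `<=` U.
Proof. by rewrite -(iso_range e) => _ [p _ <-]; exists p. Qed.

Lemma iso_point x : opens_set U x -> exists p, e p = x.
Proof. by rewrite -(iso_range e) => -[p _ <-]; exists p. Qed.

Lemma iso_D_nbhs W p : opens_set W (e p) ->
  exists2 g, ~ ideal_of p g & iso_D g `<=` W.
Proof.
move=> Wep.
have [E WE] : open (e @^-1` W).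
  by have /continuousP := @iso_continuous _ _ _ e; apply; exact: opens_open.
have : (e @^-1` W) p by [].
rewrite WE => /existsNP[g /not_implyP[Eg pg]]; exists g => // _ [q qg <-].
by rewrite -[_ (e q)]/((e @^-1` W) q) WE => /(_ g Eg).
Qed.

(** Through [iso_sheaf] at [f = 1], this makes [A -> O(U)] bijective. *)
Lemma iso_D1 : U = e @` basic_open 1 :> set X.
Proof.
apply/seteqP; split=> [x /iso_point[p <-]|]; last exact: (@iso_D_sub 1).
by exists p => //; case: (ideal_ofP p).
Qed.

Lemma iso_ring_surj s : exists f, iso_ring e f = s.
Proof.
have [_ /(_ s)[a [n na]] _] := iso_sheaf (@subset_refl _ U) iso_D1.
by exists a; move: na; rewrite /= !Ores_id expr1n rmorph1 mul1r.
Qed.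

Lemma iso_ring_inj : injective (iso_ring e).
Proof.
have [_ _ f_ker] := iso_sheaf (@subset_refl _ U) iso_D1.
move=> f g fg; apply/subr0_eq.
have [|n] := f_ker (f - g); first by rewrite /= Ores_id rmorphB /= fg subrr.
by rewrite expr1n mul1r.
Qed.

Lemma iso_D_is_D f V : V = e @` basic_open f :> set X -> is_D (iso_ring e f) V.
Proof.
move=> VE; have VU : V `<=` U by rewrite VE; exact: (@iso_D_sub f).
split=> // W WU; split=> [WV|[t ft] x Wx].
  rewrite -(Ores_comp VU WV WU); apply: invertible_morph.
  by have [] := iso_sheaf VU VE.
have [p px] := iso_point (WU _ Wx); rewrite -px VE; exists p => // pf.
rewrite -px in Wx; have [g pg gW] := iso_D_nbhs Wx.
have [_ _ pM _ p_prime] := ideal_ofP p.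
have pX k : ideal_of p (g ^+ k) -> False.
  elim: k => [|k IH]; first by case: (ideal_ofP p).
  by rewrite exprS => /p_prime[].
have [_ g_surj g_ker] := iso_sheaf (iso_D_sub (f := g)) erefl.
(* On [D(g)] the inverse of [f] is [a / g^n], so in [A] a power of [g] is a multiple of [f], and [f]
   in [p] would force [g] in [p]. *)
have [a [n]] := g_surj (Ores gW t); rewrite /= => ga.
have : (Ores (iso_D_sub (f := g)) \o iso_ring e) (g ^+ n - f * a) = 0.
  rewrite /= !(rmorphB, rmorphM) /= -ga mulrCA.
  rewrite -(Ores_comp WU gW (iso_D_sub (f := g)) (iso_ring e f)) -rmorphM ft.
  by rewrite rmorph1 mulr1 subrr.
move=> /g_ker[m]; rewrite mulrBr => /subr0_eq; rewrite -exprD => gf.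
by apply: (pX (m + n)%N); rewrite gf mulrCA mulrC; exact: pM.
Qed.

End SpecIso.

Section Affine.
Context (U : opens X) (U_affine : affine U).

Lemma affine_basis x W : opens_set U x -> opens_set W x ->
  exists s V, [/\ @is_D U s V, opens_set V x & V `<=` W].
Proof.
have [A [e]] := U_affine => /(iso_point e)[p <-] /iso_D_nbhs[g pg gW].
exists (iso_ring e g), (iso_D e g); split=> //; first exact: iso_D_is_D.
by exists p.
Qed.

Lemma affine_ring_localization s V (VU : V `<=` U) :
  is_D s V -> is_ring_localization s (Ores VU).
Proof.
have [A [e]] := U_affine; have [f <-{s}] := iso_ring_surj e s => DV.
have VE : V = e @` basic_open f :> set X.
  by rewrite (is_D_uniq DV (iso_D_is_D (V := iso_D e f) erefl)).
have [f_inv f_surj f_ker] := iso_sheaf VU VE; split=> //.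
  move=> b; have [a [n ab]] := f_surj b; exists (iso_ring e a), n.
  by move: ab; rewrite /= !rmorphXn.
move=> a; have [r <-] := iso_ring_surj e a => /f_ker[n fr].
by exists n; rewrite -rmorphXn -rmorphM fr rmorph0.
Qed.

(** Quasi-compactness of [U]: if [G] spanned a proper ideal, a prime above it would be a point in no
    [D(s)] with [s] in [G]. *)
Lemma affine_span (G : set (Osheaf U)) :
  (forall x, opens_set U x -> exists s V, [/\ G s, is_D s V & opens_set V x]) ->
  exists n (a s : 'I_n -> Osheaf U),
    (forall i, G (s i)) /\ \sum_i a i * s i = 1.
Proof.
have [A [e]] := U_affine => G_cover; apply: ideal_span1P; apply: contrapT => G1.
have [J0 JD JM] := ideal_span_ideal G.
have [||p Jp] := @prime_above A [set f | ideal_span G (iso_ring e f)].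
- split=> /= [|a b Ja Jb|a b Jb]; rewrite ?rmorph0 ?rmorphD ?rmorphM //.
    exact: JD.
  exact: JM.
- by rewrite /= rmorph1.
have Uep : opens_set U (e p) by rewrite -(iso_range e); exists p.
have [s [V [Gs DV Vep]]] := G_cover _ Uep; have [f sf] := iso_ring_surj e s.
rewrite -{s}sf in Gs DV.
have := Vep; rewrite (is_D_uniq DV (iso_D_is_D (V := iso_D e f) erefl)).
move=> [q qf /iso_inj qp]; rewrite {q}qp in qf; apply: qf; apply: Jp.
exact: ideal_span_gen.
Qed.

Lemma affine_cover n (a s : 'I_n -> Osheaf U) (V : 'I_n -> opens X) :
  \sum_i a i * s i = 1 -> (forall i, is_D (s i) (V i)) ->
  U `<=` \bigcup_i V i.
Proof.
have [A [e]] := U_affine => as1 DV x /(iso_point e)[p <-].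
have [a' a'E] := choice (fun i => iso_ring_surj e (a i)).
have [f fE] := choice (fun i => iso_ring_surj e (s i)).
apply: contrapT => Vp.
have pf i : ideal_of p (f i).
  apply: contrapT => pf; apply: Vp; exists i => //.
  rewrite (is_D_uniq (DV i) (_ : is_D _ (iso_D e (f i)))).
    by exists p.
  by rewrite -fE; exact: iso_D_is_D.
have [p0 pD pM p1 _] := ideal_ofP p.
apply: p1; suff <- : \sum_i a' i * f i = 1.
  by apply: big_ind => // i _; exact: pM.
apply: (@iso_ring_inj A U e); rewrite rmorph1 rmorph_sum -as1.
by apply: eq_bigr => i _; rewrite rmorphM a'E fE.
Qed.

End Affine.
End DistinguishedOpens.

(** * Quasi-coherent sheaves *)

(** Shrink around [x] to [V1 = D(s)] inside [W], then to [V = D(t)] inside [V1]. On [V1], [t] is a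
    fraction [a / s^k], so [V] is also [D(s a)] in [U]. *)
Lemma affine_common (X : ringed_space) (U W : opens X) x :
  affine U -> affine W -> opens_set U x -> opens_set W x ->
  exists V s t, [/\ @is_D X U s V, @is_D X W t V & opens_set V x].
Proof.
move=> U_affine W_affine Ux Wx.
have [s [V1 [DV1 V1x V1W]]] := affine_basis U_affine Ux Wx.
have [t [V [DV Vx VV1]]] := affine_basis W_affine Wx V1x.
have V1U : V1 `<=` U by case: DV1.
have [_ /(_ (Ores V1W t))[a [k ta]] _] := affine_ring_localization U_affine V1U DV1.
exists V, (s * a), t; split=> //.
have VE : V = V1 `&` V :> set X by apply/esym/setIidr.
apply: (is_D_trans (k := k) DV1 _ (is_D_restrict V1W DV VE)).
by rewrite -ta rmorphXn.
Qed.

Lemma fin_bound n (P : 'I_n -> nat -> Prop) :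
  (forall i k l, (k <= l)%N -> P i k -> P i l) ->
  (forall i, exists k, P i k) -> exists k, forall i, P i k.
Proof.
move=> P_mono /choice[k Pk]; exists (\max_i k i) => i.
exact: P_mono (leq_bigmax i) (Pk i).
Qed.

Section ModuleSheaves.
Context (X : ringed_space) (F : module_sheaf X).
Implicit Types U V W : opens X.

Lemma mresZ U V (VU : V `<=` U) a (m : F U) :
  mres F VU (a *: m) = Ores VU a *: mres F VU m.
Proof. exact: linearZ_LR. Qed.

Lemma msheaf_sep U (I : Type) (V : I -> opens X) (VU : forall i, V i `<=` U)
    (m m' : F U) :
  U `<=` \bigcup_i V i ->
  (forall i, mres F (VU i) m = mres F (VU i) m') -> m = m'.
Proof.
move=> UV mm'.
have [|t [_ t_uniq]] := msheaf_axiom VU (s := fun i => mres F (VU i) m) UV.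
  move=> i j; have VijU := subset_trans (@opensIl _ (V i) (V j)) (VU i).
  by rewrite (mres_comp (VU i) (@opensIl _ (V i) (V j)) VijU)
    (mres_comp (VU j) (@opensIr _ (V i) (V j)) VijU).
by rewrite -(t_uniq m)// -(t_uniq m')// => i; rewrite mm'.
Qed.

(* For U affine: F|U is the sheaf associated with the module F(U). *)
Definition tilde U : Prop := forall s V (VU : V `<=` U),
  is_D s V -> is_localization s (Ores VU) (mres F VU).

Lemma is_tilde_tilde (A : comPzRingType) U (e : spec_iso A U) :
  is_tilde F e -> tilde U.
Proof.
move=> [M [h h_loc]] s V VU DV.
(* At [f = 1] the localization property makes [h] onto, so the clauses for [M] pass to [F U]. *)
have h_surj n : exists m, h m = n.
  have [_ /(_ n)[m [k nm]] _] := h_loc 1 U (@subset_refl _ U) (iso_D1 e).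
  by exists m; move: nm; rewrite /= expr1n rmorph1 rmorph1 scale1r mres_id.
have [f sf] := iso_ring_surj e s; rewrite -{s}sf in DV *.
have VE : V = e @` basic_open f :> set X.
  by rewrite (is_D_uniq DV (iso_D_is_D (V := iso_D e f) erefl)).
have [_ hV_surj hV_ker] := h_loc f V VU VE; split=> [n|n].
  have [m <-] := h_surj n => /hV_ker[k fm]; exists k.
  by rewrite -rmorphXn -[LHS]linearZ fm linear0.
have [m [k nm]] := hV_surj n; exists (h m), k.
by move: nm; rewrite /= rmorphXn.
Qed.

(** The ambient [W] is kept so that the property passes to distinguished opens of [V] without
    showing them affine. *)
Definition tame V : Prop := exists W (t : Osheaf W),
  [/\ affine W, tilde W & is_D t V].

Lemma tame_sub V (b : Osheaf V) V' (V'V : V' `<=` V) : tame V -> is_D b V' ->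
  tame V' /\ is_localization b (Ores V'V) (mres F V'V).
Proof.
move=> [W [t [W_affine W_tilde DV]]] DV'.
have VW : V `<=` W by case: DV.
have V'W := subset_trans V'V VW.
have [t_inv /(_ b)[a [k ab]] _] := affine_ring_localization W_affine VW DV.
rewrite rmorphXn /= in ab; set tV := Ores VW t in t_inv ab.
have DV'a : is_D (t * a) V' by apply: (is_D_trans DV ab).
have [ker surj] := W_tilde _ _ VW DV; have [ker' surj'] := W_tilde _ _ V'W DV'a.
split; first by exists W, (t * a).
(* On [V], [t * a] is [b] times the unit [t^(k + 1)], so inverting either gives the same
   localization. *)
have taE i : Ores VW ((t * a) ^+ i) = (tV ^+ k.+1) ^+ i * b ^+ i.
  by rewrite rmorphXn rmorphM -exprMn -ab exprS mulrA.
split=> [n n0|n'].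
  have [m [j nm]] := surj n.
  have /ker'[i tam] : mres F V'W m = 0.
    rewrite -(mres_comp VW V'V V'W) -nm mresZ n0.
    exact: scaler0.
  exists i; apply: (@invertible_inj _ _ ((tV ^+ k.+1) ^+ i * tV ^+ j)).
    by apply/invertibleM; split; do ?apply: invertibleX; do ?apply: invertibleX.
  rewrite scaler0 scalerA mulrAC -taE -scalerA -rmorphXn nm -mresZ tam.
  exact: linear0.
have [m [i n'm]] := surj' n'.
have [y yt] : invertible ((tV ^+ k.+1) ^+ i) by do 2 apply: invertibleX.
exists (y *: mres F VW m), i; rewrite mresZ (mres_comp VW V'V V'W) -n'm.
rewrite -(Ores_comp VW V'V V'W) taE rmorphM !scalerA mulrA -rmorphM.
by rewrite [y * _]mulrC yt rmorph1 mul1r.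
Qed.

(** [U] has a finite cover by tame distinguished opens. A section over [V = D(s)], times a power of
    [s], extends to each of them; a further power makes the extensions agree on overlaps, and
    finiteness makes the exponents uniform. *)
Lemma quasi_coherent_affine U : quasi_coherent F -> affine U -> tilde U.
Proof.
move=> F_qc U_affine s V VU DV.
pose G := [set r : Osheaf U | exists V, is_D r V /\ tame V].
have [|n [a [r [Gr ar1]]]] := @affine_span _ _ U_affine G.
  move=> x Ux; have [W [A [e [Wx /is_tilde_tilde W_tilde]]]] := F_qc x.
  have W_affine : affine W by exists A.
  have [Vx [sx [t [DsV DtV Vxx]]]] := affine_common U_affine W_affine Ux Wx.
  by exists sx, Vx; split=> //; exists Vx; split=> //; exists W, t.
have [Vr /all_and2[DVr Vr_tame]] := choice Gr.
have VrU i : Vr i `<=` U by case: (DVr i).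
have U_cover := affine_cover U_affine ar1 DVr.
have DVrV i : is_D (Ores (VrU i) s) (opensI (Vr i) V).
  exact: is_D_restrict DV _.
have VrV_loc i := (tame_sub (@opensIl _ (Vr i) V) (Vr_tame i) (DVrV i)).2.
split=> [m m0|n0].
  have [k sm] : exists k, forall i, mres F (VrU i) (s ^+ k *: m) = 0.
    apply: fin_bound => [i k l kl|i].
      by move=> sm; rewrite -(subnK kl) exprD -scalerA mresZ sm [LHS]scaler0.
    have [ker _] := VrV_loc i; have [|k sm] := ker (mres F (VrU i) m).
      rewrite (mres_comp _ _ (subset_trans (@opensIl _ (Vr i) V) (VrU i))).
      rewrite -(mres_comp VU (@opensIr _ (Vr i) V)) m0; exact: linear0.
    by exists k; rewrite mresZ rmorphXn.
  by exists k; apply: (msheaf_sep U_cover) => i; rewrite sm linear0.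
pose VrVV i : opensI (Vr i) V `<=` V := @opensIr _ (Vr i) V.
have [k] : exists k, forall i, exists m, mres F (@opensIl _ (Vr i) V) m =
    mres F (VrVV i) (Ores VU (s ^+ k) *: n0).
  apply: fin_bound => [i k l kl [m mE]|i].
    exists (Ores (VrU i) (s ^+ (l - k)) *: m); rewrite mresZ mE.
    rewrite -{2}(subnK kl) exprD rmorphM -scalerA [RHS]mresZ; congr (_ *: _).
    have VriVU := subset_trans (@opensIl _ (Vr i) V) (VrU i).
    by rewrite (Ores_comp _ _ VriVU) (Ores_comp _ _ VriVU).
  have [_ surj] := VrV_loc i; have [m [k mE]] := surj (mres F (VrVV i) n0).
  exists k, m; rewrite -mE mresZ -rmorphXn; congr (_ *: _).
  have VriVU := subset_trans (@opensIl _ (Vr i) V) (VrU i).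
  by rewrite (Ores_comp _ _ VriVU) (Ores_comp _ _ VriVU).
move=> n0_ext; pose m i := projT1 (cid (n0_ext i)).
have mE i : mres F (@opensIl _ (Vr i) V) (m i) =
    mres F (VrVV i) (Ores VU (s ^+ k) *: n0) by exact: projT2 (cid (n0_ext i)).
pose Vij i j := opensI (Vr i) (Vr j).
pose VijU i j : Vij i j `<=` U := subset_trans (@opensIl _ (Vr i) (Vr j)) (VrU i).
pose d i j := mres F (@opensIl _ (Vr i) (Vr j)) (m i) -
  mres F (@opensIr _ (Vr i) (Vr j)) (m j).
(* The extensions agree on the part of each overlap inside [V]; the overlaps are tame, so a power of
   [s] kills the differences. *)
have [l sd] : exists l, forall i j, Ores (VijU i j) (s ^+ l) *: d i j = 0.
  apply: fin_bound => [i l l' ll' sd j|i].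
    by rewrite -(subnK ll') exprD rmorphM -scalerA sd scaler0.
  apply: fin_bound => [j l l' ll' sd|j].
    by rewrite -(subnK ll') exprD rmorphM -scalerA sd scaler0.
  have DVij : is_D (Ores (VrU i) (r j)) (Vij i j).
    exact: is_D_restrict (DVr j) _.
  have [Vij_tame _] := tame_sub (@opensIl _ _ _) (Vr_tame i) DVij.
  have DVijV : is_D (Ores (VijU i j) s) (opensI (Vij i j) V).
    exact: is_D_restrict DV _.
  have [_ [ker _]] := tame_sub (@opensIl _ _ _) Vij_tame DVijV.
  have [|l sd] := ker (d i j); last by exists l; rewrite rmorphXn.
  set P := opensI (Vij i j) V.
  have Pi : P `<=` opensI (Vr i) V by move=> x [[]].
  have Pj : P `<=` opensI (Vr j) V by move=> x [[]].
  have PV : P `<=` V by move=> x [].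
  have PVi : P `<=` Vr i by move=> x [[]].
  have PVj : P `<=` Vr j by move=> x [[]].
  rewrite /d linearB (mres_comp _ _ PVi) (mres_comp _ _ PVj).
  rewrite -(mres_comp (@opensIl _ (Vr i) V) Pi).
  rewrite -(mres_comp (@opensIl _ (Vr j) V) Pj).
  by rewrite !mE (mres_comp _ _ PV) (mres_comp _ _ PV) subrr.
have [|m0 [m0E _]] := msheaf_axiom VrU
  (s := fun i => Ores (VrU i) (s ^+ l) *: m i) U_cover.
  move=> i j; apply/subr0_eq; rewrite -[RHS](sd i j) /d scalerBr.
  by rewrite !mresZ (Ores_comp _ _ (VijU i j)) (Ores_comp _ _ (VijU i j)).
exists m0, (l + k)%N; apply: (msheaf_sep (VU := VrVV)) => [x Vx|i].
  by have [i _ Vix] := U_cover x (VU x Vx); exists i.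
have VriVU := subset_trans (@opensIl _ (Vr i) V) (VrU i).
rewrite (mres_comp _ _ VriVU) -(mres_comp (VrU i) (@opensIl _ (Vr i) V) VriVU).
rewrite m0E [RHS]mresZ mE exprD rmorphM -scalerA [LHS]mresZ; congr (_ *: _).
by rewrite (Ores_comp _ _ VriVU) (Ores_comp _ _ VriVU).
Qed.

End ModuleSheaves.

(** * F-total acyclicity on an arbitrary affine open *)

Theorem corollary2p8 (X : scheme) (F : sheaf_complex X)
    (F_qc : forall i, quasi_coherent (F i))
    (F_flat : forall i, flat_sheaf (F i)) :
  (exists2 c : set (opens X), affine_open_covering c &
     forall U, c U -> F_totally_acyclic (sections F U)) ->
  F_totally_acyclic_sheaf F.
Proof.
move=> [c [c_affine c_cover] c_acy]; split=> // U U_affine.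
have F_loc (W : opens X) s (V : opens X) (VW : V `<=` W) : affine W -> is_D s V ->
    forall i, is_localization s (Ores VW) (mres (F i) VW).
  by move=> W_affine DV i; exact: (quasi_coherent_affine (F_qc i)).
pose G := [set s : Osheaf U | exists V (W : opens X) (t : Osheaf W),
  [/\ c W, is_D s V & is_D t V]].
have [x Ux|n [a [s [Gs as1]]]] := @affine_span _ _ U_affine G.
  have [W cW Wx] : (\bigcup_(W in c) (W : set X)) x by rewrite c_cover.
  have [V [s [t [DsV DtV Vx]]]] := affine_common U_affine (c_affine _ cW) Ux Wx.
  by exists s, V; split=> //; exists V, W, t.
split; first by move=> i; exact: F_flat.
- apply: (acyclic_glue as1) => j i x.
  have [V [W [t [cW DsV DtV]]]] := Gs j.
  have [[VU _] [VW _]] := (DsV, DtV).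
  have [_ W_acy _] := c_acy W cW.
  apply: (locally_boundary (C := sections F U) (D := sections F V)
    (affine_ring_localization U_affine VU DsV)
    (h := fun i => mres (F i) VU) (F_loc _ _ _ VU U_affine DsV)).
    by move=> i' x'; exact: sdiff_natural.
  apply: (acyclic_localization (C := sections F W) (D := sections F V)
    (affine_ring_localization (c_affine _ cW) VW DtV)
    (h := fun i => mres (F i) VW) (F_loc _ _ _ VW (c_affine _ cW) DtV)) => //.
  by move=> i' x'; exact: sdiff_natural.
- move=> I I_inj; apply: (acyclic_tensor_glue as1 I_inj) => j T theta T0 thetaE i z.
  have [V [W [t [cW DsV DtV]]]] := Gs j.
  have [[VU _] [VW _]] := (DsV, DtV).
  have U_loc := affine_ring_localization U_affine VU DsV.
  have W_loc := affine_ring_localization (c_affine _ cW) VW DtV.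
  have [_ _ W_acy] := c_acy W cW.
  (* It remains to treat [E = Hom_R(O(V), I)], with [R = O(U)]; tensoring with it is compared over
     [O(U)], [O(V)] and finally [O(W)], where [E] is injective. *)
  apply: (tensor_boundary_of_coind U_loc T0 thetaE).
  apply/(acyclic_tensor_localization (C := sections F U) (D := sections F V)
    U_loc (h := fun i => mres (F i) VU) (F_loc _ _ _ VU U_affine DsV)).
    by move=> i' x'; exact: sdiff_natural.
  apply/(acyclic_tensor_localization (C := sections F W) (D := sections F V)
    W_loc (h := fun i => mres (F i) VW) (F_loc _ _ _ VW (c_affine _ cW) DtV)).
    by move=> i' x'; exact: sdiff_natural.
  by apply: W_acy; exact: coind_injective W_loc I_inj.
Qed.
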